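(* Let $m\in\mathbb{N}$ and let $\mathcal{C}=\mathcal{C}^{\perp}\leq \mathbb{F}_2^{24m}$ be an extremal binary self-dual code of length $24m$. Let $\sigma\in\mathrm{Aut}(\mathcal{C})$ be a fixed point free automorphism of order $2$. If $m$ is odd, or if $m=2\mu$ with $\binom{5\mu-1}{\mu-1}$ odd, then $\mathcal{C}$ is a free $\mathbb{F}_2\langle\sigma\rangle$-module.
   Context: A binary self-dual code $\mathcal{C}=\mathcal{C}^\perp\leq\mathbb{F}_2^{24m}$ (orthogonality with respect to the standard inner product) is called extremal if its minimum distance is $d(\mathcal{C})=4m+4$. $\mathrm{Aut}(\mathcal{C})=\{\sigma\in S_{24m}\mid \sigma(\mathcal{C})=\mathcal{C}\}$ is the group of coordinate permutations preserving $\mathcal{C}$; $\sigma$ is fixed point free if it fixes no coordinate. $\mathcal{C}$ is regarded as a module over the group algebra $\mathbb{F}_2\langle\sigma\rangle$ via the permutation action. *)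

(* Defs.v *)
From HB Require Import structures.
From mathcomp Require Import all_boot all_order all_algebra all_fingroup.
Set Implicit Arguments. Unset Strict Implicit. Unset Printing Implicit Defensive.
Import GRing.Theory.
Local Open Scope ring_scope.

Definition dotF2 n (x y : 'rV['F_2]_n) : 'F_2 := \sum_(i < n) x 0 i * y 0 i.

Definition wt n (x : 'rV['F_2]_n) : nat := #|[set i : 'I_n | x 0 i != 0]|.

Definition self_dual n (C : {vspace 'rV['F_2]_n}) : Prop :=
  forall x : 'rV['F_2]_n, x \in C <-> (forall y, y \in C -> dotF2 x y = 0).

Definition min_dist_is n (C : {vspace 'rV['F_2]_n}) (d : nat) : Prop :=
  (exists2 c, c \in C & (c != 0) && (wt c == d)) /\
  (forall c, c \in C -> c != 0 -> (d <= wt c)%N).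

Definition extremal m (C : {vspace 'rV['F_2]_(24 * m)}) : Prop :=
  self_dual C /\ min_dist_is C (4 * m + 4).

Definition pact n (s : 'S_n) (x : 'rV['F_2]_n) : 'rV['F_2]_n := col_perm s x.

Definition in_Aut n (s : 'S_n) (C : {vspace 'rV['F_2]_n}) : Prop :=
  forall x, (pact s x \in C) = (x \in C).

Definition fixed_point_free n (s : 'S_n) : Prop := forall i, s i != i.

(* C is a free F_2<s>-module (s of order 2, so F_2<s> has F_2-basis {1, s}):
   there are b_1..b_k in C which form a basis over F_2<s>, i.e. the family
   b_1..b_k, s b_1..s b_k is an F_2-basis of C. *)
Definition free_module_order2 n (s : 'S_n) (C : {vspace 'rV['F_2]_n}) : Prop :=
  exists (k : nat) (b : k.-tuple 'rV['F_2]_n),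
    [/\ all (fun x => x \in C) b,
        free (b ++ map (pact s) b) &
        (<<b ++ map (pact s) b>> = C)%VS].

(* Main.v *)
Require Import Defs.
From HB Require Import structures.
From mathcomp Require Import all_boot all_order all_algebra all_fingroup.
From mathcomp Require Import zify ring lra.
Set Implicit Arguments. Unset Strict Implicit. Unset Printing Implicit Defensive.
Import Order.TTheory GRing.Theory Num.Theory.

(**
Let [tr c = c + s c].  [C] is free as soon as every [s]-fixed word of [C] is
some [tr c].  Keeping one coordinate per orbit of [s], the words [tr c] and the
fixed words of [C] become codes [E <= D] of length [12m] with [D] dual to [E]
and [d(D) >= 2m + 2], so the claim is [D = E].

Let [S] be the shadow of [E], the set of [v] with [v.c = wt c / 2 mod 2] on [E].
In [z = y^2] the weight enumerators of [E], [D] and [S] are linear images of one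
coefficient vector [e], with respect to the bases [(1+z)^(6m-2i) (1-6z+z^2)^i],
the same with signs [(-1)^i], and [y^(6m-2i) (1+y^4)^i].  The odd part of [e]
is fixed modulo [z^(m+1)] by the minimum distance, and Lagrange inversion
evaluates [sum_b e_(2b+1) C(b,m)] from it; on the shadow side the same sum is
[sum_l S_(6m+2+4l) C(l+m,2m)] up to a power of 2.  Comparing the two gives, for
[|D| = 4^k |E|] and the all-one word in [E],
   [(2^k - 1) nu = 4 (-1)^m sum_l S_(6m+2+4l) C(l+m,2m)]
with [nu > 0], which is impossible for [m] odd by its sign, and for [m = 2h] by
its 2-adic valuation since then [nu = 6 C(5h-1,h-1)].

If the all-one word is not in [E] (which happens only when [C] is not doubly
even), [2^k] is replaced by [2^(k-1)], and the case [k = 1] is excluded by the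
same comparison for the words of odd weight in [D] and [S].
*)

(** * Binomial sums *)

Lemma bin_second_difference l m :
  'C(l + m.+2, (2 * m).+2) + 'C(l + m, (2 * m).+2) =
  2 * 'C(l + m.+1, (2 * m).+2) + 'C(l + m, 2 * m).
Proof. by rewrite !addnS !binS; lia. Qed.

(** The operator g(l-1) + 2g(l) + g(l+1) is moved from g to f. The term [3 * g 0 + g 1] is its value
    at 0 under the reflection g(-1) = g(0), which the half row of binomials used below satisfies. *)
Lemma summation_by_parts2 (f g : nat -> nat) K :
  f 0 * (3 * g 0 + g 1) + \sum_(l < K) f l.+1 * (g l + 2 * g l.+1 + g l.+2)
    + f K.+1 * g K =
  2 * (\sum_(l < K.+1) f l * g l) + (f 1 + f 0) * g 0
    + \sum_(l < K) (f l.+2 + f l) * g l.+1 + f K * g K.+1.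
Proof.
elim: K => [|K IHK]; first by rewrite big_ord1 !big_ord0 /=; lia.
move: IHK; rewrite !big_ord_recr /=.
by lia.
Qed.

(** Induction on b: passing from row 2b+1 to row 2b+3 applies the operator above to the half row
    [g]. Moved to the weights, it turns [f m.+1] into 4 [f m.+1] + [f m], and the claim becomes
    Pascal's rule for C(b+1, m+1). *)
Lemma bin_central_sum b m L : b < L ->
  4 ^ m * (\sum_(l < L) 'C(l + m, 2 * m) * 'C((2 * b).+1, b.+1 + l)) =
  4 ^ b * 'C(b, m).
Proof.
elim: b m L => [|b IHb] m [|L] // ltbL.
  rewrite big_ord_recl big1 ?addn0 /= => [|i _].
    by case: m => [|m] //; rewrite (bin_small (m := 2 * m.+1)) ?muln0 ?bin_small //; lia.
  by rewrite (bin_small (m := _ + _)) ?muln0 //; lia.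
pose g l := 'C((2 * b).+1, b.+1 + l).
pose f k l := 'C(l + k, 2 * k).
have gL l : b < l -> g l = 0 by move=> ?; rewrite /g bin_small //; lia.
have gS l : 'C((2 * b.+1).+1, b.+2 + l.+1) = g l + 2 * g l.+1 + g l.+2.
  by rewrite /g mulnS !addnS !addSn !binS; lia.
have g0 : 'C((2 * b.+1).+1, b.+2 + 0) = 3 * g 0 + g 1.
  have: 'C((2 * b).+1, b.+1) = 'C((2 * b).+1, b).
    by rewrite -bin_sub; [congr 'C(_, _)|]; lia.
  have binSS n k : 'C(n.+2, k.+2) = 'C(n, k.+2) + 2 * 'C(n, k.+1) + 'C(n, k).
    by rewrite !binS; lia.
  by rewrite /g mulnS !addSn binSS !addn0 addn1 => <-; rewrite add0n; lia.
have sumE : \sum_(l < L.+1) 'C(l + m, 2 * m) * 'C((2 * b.+1).+1, b.+2 + l) =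
    2 * (\sum_(l < L.+1) f m l * g l) + (f m 1 + f m 0) * g 0
      + \sum_(l < L) (f m l.+2 + f m l) * g l.+1.
  rewrite big_ord_recl g0; under eq_bigr => i _ do rewrite lift0 gS.
  have := summation_by_parts2 (f m) g L.
  have [-> ->] : g L = 0 /\ g L.+1 = 0 by split; apply: gL; lia.
  by rewrite !muln0 !addn0 => <-.
rewrite {}sumE.
have IH k : 4 ^ k * (\sum_(l < L.+1) f k l * g l) = 4 ^ b * 'C(b, k).
  by apply: IHb; lia.
have recl k : \sum_(l < L.+1) f k l * g l = f k 0 * g 0 + \sum_(l < L) f k l.+1 * g l.+1.
  by rewrite big_ord_recl.
case: m => [|m].
  have f0 l : f 0 l = 1 by rewrite /f muln0 bin0.
  have -> : \sum_(l < L) (f 0 l.+2 + f 0 l) * g l.+1 = 2 * \sum_(l < L) f 0 l.+1 * g l.+1.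
    by rewrite big_distrr /=; apply: eq_bigr => i _; rewrite !f0; lia.
  by have := IH 0; rewrite recl !f0 !bin0 expnS; lia.
have fS l : f m.+1 l.+2 + f m.+1 l = 2 * f m.+1 l.+1 + f m l.+1.
  by have := bin_second_difference l.+1 m; rewrite /f mulnS !addSn !addnS => ->.
have f1 : f m.+1 1 + f m.+1 0 = 2 * f m.+1 0 + f m 0.
  rewrite /f !add0n; case: (m) => [|k] //.
  by rewrite !bin_small //; lia.
under [X in _ + X]eq_bigr => i _ do rewrite fS mulnDl -mulnA.
rewrite f1 big_split -big_distrr /=.
have := IH m; have := IH m.+1; rewrite !recl binS !expnS.
move: (\sum_(l < L) f m.+1 _ * _) (\sum_(l < L) f m _ * _) => s1 s2.
by move: (f _ _) (f _ _) (g 0) (4 ^ _) (4 ^ _) => *; lia.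
Qed.

Local Open Scope ring_scope.

(** * Lagrange inversion *)

(** Congruence modulo X^M: power series are handled through their truncations. *)
Definition eqX (M : nat) (A B : {poly rat}) :=
  forall k, (k < M)%N -> A`_k = B`_k.

Lemma eqXM M A A' B B' : eqX M A A' -> eqX M B B' -> eqX M (A * B) (A' * B').
Proof.
move=> eA eB k ltkM; rewrite !coefM; apply: eq_bigr => i _.
by rewrite eA ?eB //; have := ltn_ord i; lia.
Qed.

Lemma eqXMl M A B B' : eqX M B B' -> eqX M (A * B) (A * B').
Proof. exact: eqXM. Qed.

Lemma eqXD M A A' B B' : eqX M A A' -> eqX M B B' -> eqX M (A + B) (A' + B').
Proof. by move=> eA eB k ltkM; rewrite !coefD eA ?eB. Qed.

Lemma eqXX M A A' k : eqX M A A' -> eqX M (A ^+ k) (A' ^+ k).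
Proof. by move=> eA; elim: k => [|k IHk] //; rewrite !exprS; apply: eqXM. Qed.

Lemma eqX_trans M A B C : eqX M A B -> eqX M B C -> eqX M A C.
Proof. by move=> eAB eBC k ltkM; rewrite eAB ?eBC. Qed.

Lemma eqX_sym M A B : eqX M A B -> eqX M B A.
Proof. by move=> eAB k ltkM; rewrite eAB. Qed.

(* The truncation of (1 - X)^-(r+1). *)
Definition geo M r : {poly rat} := \poly_(k < M) ('C(r + k, r))%:R.

Lemma coef_sub1X (A : {poly rat}) k :
  ((1 - 'X) * A)`_k = A`_k - (if k is k'.+1 then A`_k' else 0).
Proof. by rewrite mulrBl mul1r coefB coefXM; case: k. Qed.

Lemma geoS M r : eqX M ((1 - 'X) * geo M r.+1) (geo M r).
Proof.
move=> k ltkM; rewrite coef_sub1X !coef_poly ltkM.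
case: k ltkM => [|k] ltkM; first by rewrite !addn0 !binn subr0.
by rewrite coef_poly ltnW // addnS binS natrD addrAC subrr add0r addSnnS.
Qed.

Lemma geo0 M : eqX M ((1 - 'X) * geo M 0) 1.
Proof.
move=> k ltkM; rewrite coef_sub1X coef_poly ltkM coef1.
case: k ltkM => [|k] ltkM; first by rewrite !addn0 !binn subr0.
by rewrite coef_poly ltnW // !bin0 subrr.
Qed.

Lemma geoK M r : eqX M ((1 - 'X) ^+ r.+1 * geo M r) 1.
Proof.
elim: r => [|r IHr]; first exact: geo0.
rewrite exprSr -mulrA; apply: eqX_trans IHr; apply: eqXMl; exact: geoS.
Qed.

Lemma geo_exp M r : eqX M (geo M r) (geo M 0 ^+ r.+1).
Proof.
have H : eqX M ((1 - 'X) ^+ r.+1 * geo M 0 ^+ r.+1) 1.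
  by have := eqXX r.+1 (@geo0 M); rewrite exprMn expr1n.
apply: (@eqX_trans _ _ (geo M r * ((1 - 'X) ^+ r.+1 * geo M 0 ^+ r.+1))).
  by rewrite -[X in eqX _ X]mulr1; apply/eqXMl/eqX_sym.
by rewrite mulrA [geo M r * _]mulrC -[X in eqX _ _ X]mul1r; apply: eqXM => //; apply: geoK.
Qed.

(* The truncation of (1 - X^2)^-(r+1). *)
Definition geo2 M r : {poly rat} := geo M r \Po 'X^2.

Lemma coef_geo2 M r k : (k < 2 * M)%N ->
  (geo2 M r)`_k = (if odd k then 0 else 'C(r + k./2, r))%:R.
Proof.
move=> ltkM; rewrite coef_comp_poly_Xn // coef_poly dvdn2 divn2.
by case: (odd k) => //=; rewrite (_ : _ < M)%N //; lia.
Qed.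

Lemma geo2K M r : eqX M ((1 - 'X ^+ 2) ^+ r.+1 * geo2 M r) 1.
Proof.
have -> : (1 - 'X ^+ 2) ^+ r.+1 * geo2 M r = ((1 - 'X) ^+ r.+1 * geo M r) \Po 'X^2.
  by rewrite comp_polyM rmorphXn /= comp_polyB comp_polyX -[1 in RHS]polyC1 comp_polyC polyC1.
move=> k ltkM; rewrite coef_comp_poly_Xn // coef1.
case: ifP => [|]; rewrite dvdn2; last by case: k {ltkM} => //.
move=> ek; rewrite geoK ?coef1 ?divn2; last by lia.
by congr (_%:R); move: ek; case: k {ltkM} => [|[|k]].
Qed.

Section Lagrange.
Let p : {poly rat} := 1 + 'X.
Let q : {poly rat} := 1 - 6 * 'X + 'X ^+ 2.
Let w : {poly rat} := 'X * (1 - 'X) ^+ 2.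

(** Expanding q^(2b) with this identity reduces odd powers of q to the family evaluated in
    [Phi_basis]. *)
Lemma quartic_split : q ^+ 2 = p ^+ 4 - 16 * w.
Proof. by rewrite /q /p /w; ring. Qed.

(* Modulo X^M the polynomial is -(1/e) X^(e+1) times the derivative of
   (p^4 / (X (1 - X)^2))^e, and a derivative has no residue. *)
Lemma residue_vanishes M e : (0 < e < M)%N ->
  (q * p ^+ (4 * e - 1) * geo M 0 ^+ (2 * e).+1)`_e = 0.
Proof.
case: e => // e /= lteM; set B := geo M 0.
have dB : eqX M ('X * B^`()) ('X * B ^+ 2).
  move=> [|k] ltkM; rewrite !coefXM //= coef_deriv.
  have := @geo_exp M 1 k (ltnW ltkM); rewrite -/B => <-.
  by rewrite !coef_poly ltkM ltnW // bin0 add1n bin1.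
set Y := p ^+ (4 * e.+1) * B ^+ (2 * e.+1).
have Y0 : ('X * Y^`() - e.+1%:R *: Y)`_e.+1 = 0.
  by rewrite coefB coefXM coefZ coef_deriv /= mulr_natl subrr.
have: eqX M ('X * Y^`() - e.+1%:R *: Y)
    ((- e.+1%:R) *: (q * p ^+ (4 * e.+1 - 1) * B ^+ (2 * e.+1).+1)).
  have [E4 E2] : (4 * e.+1 = (4 * e.+1 - 1).+1)%N /\ (2 * e.+1 = (2 * e.+1 - 1).+1)%N by lia.
  have p' : p^`() = 1 by rewrite /p derivD derivX -polyC1 derivC add0r.
  set P := p ^+ (4 * e.+1 - 1); set U := B ^+ (2 * e.+1 - 1).
  have dY : 'X * Y^`() - e.+1%:R *: Y = (4 * 'X - p) * e.+1%:R * P * (U * B)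
      + 2 * e.+1%:R * p * P * U * ('X * B^`()).
    rewrite /Y derivM !deriv_exp p' E4 E2 /= -/P -/U !exprSr -/P -/U -E4 -E2.
    rewrite scaler_nat -[_ *+ (4 * _)]mulr_natl -[_ *+ (2 * _)]mulr_natl.
    by rewrite -[_ *+ e.+1]mulr_natl !natrM; move: (e.+1%:R) => c; ring.
  have Bgeo : eqX M (U * B) (U * B * ((1 - 'X) * B)).
    by rewrite -[X in eqX _ X]mulr1; apply/eqXMl/eqX_sym/geo0.
  rewrite dY; apply: eqX_trans (eqXD (eqXMl _ Bgeo) (eqXMl _ dB)) _.
  rewrite scaleNr scaler_nat -[(q * _ * _) *+ e.+1]mulr_natl /q /p.
  have -> : B ^+ (2 * e.+1).+1 = U * B * B by rewrite E2 !exprSr.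
  have eqX_refl A C : A = C -> eqX M A C by move=> ->.
  apply: eqX_refl; by move: (e.+1%:R) => c; ring.
move=> /(_ _ lteM); rewrite Y0 coefZ => /esym/eqP; rewrite mulf_eq0 oppr_eq0 pnatr_eq0.
by move/eqP.
Qed.

(** The coefficient of X^m in A (1+X)^2 / (1-X^2)^(2m+1). This is the Lagrange residue that reads
    off the coefficient at j = m in the family [q * p ^+ (6 * m - 2 - 4 * j) * w ^+ j]. *)
Definition Phi m (A : {poly rat}) : rat :=
  (A * p ^+ 2 * geo2 m.+1 (2 * m))`_m.

Lemma PhiD m A B : Phi m (A + B) = Phi m A + Phi m B.
Proof. by rewrite /Phi !mulrDl coefD. Qed.

Lemma PhiZ m c A : Phi m (c *: A) = c * Phi m A.
Proof. by rewrite /Phi -!scalerAl coefZ. Qed.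

Lemma Phi_sum m I (r : seq I) (P : pred I) (F : I -> {poly rat}) :
  Phi m (\sum_(i <- r | P i) F i) = \sum_(i <- r | P i) Phi m (F i).
Proof. by rewrite /Phi !mulr_suml coef_sum. Qed.

Lemma Phi_eqX m A B : eqX m.+1 A B -> Phi m A = Phi m B.
Proof. by move=> eAB; rewrite /Phi -!mulrA; apply: (eqXM eAB). Qed.

(** For j > m the factor X^j kills the coefficient, and for j = m only constant terms 1 remain. For
    e = m - j > 0 a factor p^(2m+1) cancels against the denominator (1-X^2)^(2m+1), which leaves the
    expression of [residue_vanishes]. *)
Lemma Phi_basis m j : (0 < m)%N -> (4 * j <= 6 * m - 2)%N ->
  Phi m (q * p ^+ (6 * m - 2 - 4 * j) * w ^+ j) = (j == m)%:R.
Proof.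
move=> m_gt0 lej; set N := geo2 m.+1 (2 * m).
set R := q * (1 - 'X) ^+ (2 * j) * p ^+ (6 * m - 2 - 4 * j) * p ^+ 2 * N.
have -> : Phi m (q * p ^+ (6 * m - 2 - 4 * j) * w ^+ j) = ('X^j * R)`_m.
  by rewrite /Phi -/N /w /R exprMn -exprM; congr ((polyseq _)`__); ring.
rewrite coefXnM; case: (ltngtP j m) => [ltjm||->] //; last first.
  have N0 : N.[0] = 1 by rewrite horner_coef0 coef_geo2 //= addn0 binn.
  rewrite subnn -horner_coef0 /R !hornerM N0 !horner_exp /q /p !hornerE.
  by rewrite ?(subr0, addr0, mulr0, oppr0, expr1n, mulr1, expr0n).
have [e e_gt0 Em] : exists2 e, (0 < e)%N & m = (j + e)%N by exists (m - j)%N; lia.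
have -> : (m - j)%N = e by lia.
set B := geo m.+1 0.
have pN : eqX m.+1 (p ^+ (2 * m).+1 * N) (B ^+ (2 * m).+1).
  have BK : eqX m.+1 1 ((1 - 'X) ^+ (2 * m).+1 * B ^+ (2 * m).+1).
    by apply: eqX_sym; have := eqXX (2 * m).+1 (@geo0 m.+1); rewrite exprMn expr1n.
  rewrite -[X in eqX _ X]mulr1; apply: eqX_trans (eqXMl _ BK) _.
  rewrite mulrA -[X in eqX _ _ X]mul1r; apply: eqXM => //.
  rewrite mulrAC -exprMn (_ : p * (1 - 'X) = 1 - 'X ^+ 2); last by rewrite /p; ring.
  exact: geo2K.
have RE : eqX m.+1 R (q * p ^+ (4 * e - 1) * B ^+ (2 * e).+1).
  have -> : R = q * p ^+ (4 * e - 1) * ((1 - 'X) ^+ (2 * j) * (p ^+ (2 * m).+1 * N)).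
    rewrite /R -[_ * p ^+ 2]mulrA -exprD.
    have -> : (6 * m - 2 - 4 * j + 2 = 4 * e - 1 + (2 * m).+1)%N by lia.
    by rewrite exprD; ring.
  apply: eqXMl; apply: eqX_trans (eqXMl _ pN) _.
  have -> : (2 * m).+1 = (2 * j + (2 * e).+1)%N by lia.
  rewrite exprD mulrA -exprMn -[X in eqX _ _ X]mul1r; apply: eqXM => //.
  by have := eqXX (2 * j) (@geo0 m.+1); rewrite expr1n.
rewrite RE ?residue_vanishes //; lia.
Qed.

Lemma Phi_odd m b : (0 < m)%N -> (2 * b < 3 * m)%N ->
  Phi m (q ^+ (2 * b).+1 * p ^+ (6 * m - 2 - 4 * b)) = (-16) ^+ m * 'C(b, m)%:R.
Proof.
move=> m_gt0 ltb; rewrite exprS exprM quartic_split exprDn.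
rewrite mulr_sumr mulr_suml Phi_sum.
transitivity (\sum_(j < b.+1) (-16) ^+ j * 'C(b, j)%:R * (j == m :> nat)%:R : rat).
  apply: eq_bigr => -[j /= lejb] _.
  rewrite -(@Phi_basis m j) //; last by lia.
  rewrite -PhiZ; congr (Phi _ _).
  have -> : (6 * m - 2 - 4 * j = 4 * (b - j) + (6 * m - 2 - 4 * b))%N by lia.
  rewrite -mul_polyC polyCM rmorphXn rmorphN /= polyC_natr exprD -exprM.
  rewrite -mulNr exprMn -mulr_natl polyC_natr; ring.
have [ltbm|lemb] := ltnP b m.
  rewrite bin_small // mulr0 big1 // => -[j /= ltj] _.
  by rewrite (_ : j == m = false) ?mulr0 //; lia.
rewrite (bigD1 (Ordinal (lemb : (m < b.+1)%N))) //= eqxx mulr1 big1 ?addr0 //.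
move=> [j ltj]; rewrite -val_eqE /= => /negPf->; by rewrite mulr0.
Qed.

End Lagrange.

Lemma eqX_comp2 M A B : eqX M A B -> eqX M (A \Po 'X^2) (B \Po 'X^2).
Proof.
move=> eAB k ltkM; rewrite !coef_comp_poly_Xn //; case: ifP => // _.
by rewrite eAB // (leq_ltn_trans _ ltkM) // leq_div.
Qed.

Lemma geo2S M r : eqX M ((1 - 'X ^+ 2) * geo2 M r.+1) (geo2 M r).
Proof.
have := eqX_comp2 (@geoS M r); rewrite comp_polyM comp_polyB comp_polyX.
by rewrite -[in 1 \Po _]polyC1 comp_polyC polyC1.
Qed.

(** * Values of [Phi] for odd and for even m *)

Section Values.
Let p : {poly rat} := 1 + 'X.
Let q : {poly rat} := 1 - 6 * 'X + 'X ^+ 2.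

Lemma coef_p2 (A : {poly rat}) k : (p ^+ 2 * A)`_k.+2 = A`_k.+2 + 2 * A`_k.+1 + A`_k.
Proof.
have -> : p ^+ 2 * A = A + 'X * (2%:P * A + 'X * A) by rewrite /p polyC_natr; ring.
by rewrite !(coefD, coefXM, coefCM) /= addrA.
Qed.

Lemma coef_p2_1 (A : {poly rat}) : (p ^+ 2 * A)`_1 = A`_1 + 2 * A`_0.
Proof.
have -> : p ^+ 2 * A = A + 'X * (2%:P * A + 'X * A) by rewrite /p polyC_natr; ring.
by rewrite !(coefD, coefXM, coefCM) /= addr0.
Qed.

(** The series 1/(1-X^2)^(2m+1) has nonnegative coefficients, and the term 2X of (1+X)^2 meets its
    positive coefficient of even degree m-1. *)
Lemma Phi1_odd m : odd m -> 0 < Phi m 1.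
Proof.
rewrite /Phi mul1r -/p => om.
have geo_ge0 k : (k < 2 * m.+1)%N -> 0 <= (geo2 m.+1 (2 * m))`_k.
  by move=> ltk; rewrite coef_geo2 // ler0n.
have geo_gt0 : 0 < (geo2 m.+1 (2 * m))`_m.-1.
  rewrite coef_geo2; last by lia.
  have -> : odd m.-1 = false by lia.
  by rewrite ltr0n bin_gt0; lia.
case: m om geo_ge0 geo_gt0 => [|[|m]] // om ge0 gt0.
  by rewrite coef_p2_1; have := ge0 1 isT; move: gt0 => /=; lra.
rewrite coef_p2; have := ge0 m.+2; have := ge0 m; move: gt0 => /=.
have [-> ->] : ((m < 2 * m.+3) /\ (m.+2 < 2 * m.+3))%N by lia.
by move=> ? /(_ isT) ? /(_ isT) ?; lra.
Qed.

Lemma bin_5h h : 'C(5 * h.+1, h.+1) = (5 * 'C(5 * h.+1 - 1, h))%N.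
Proof.
have := mul_bin_diag (5 * h.+1) h.
rewrite (_ : (5 * h.+1).-1 = (5 * h.+1 - 1)%N); last by lia.
rewrite -mulnA mulnCA => /eqP; rewrite eqn_pmul2l // => /eqP ->; lia.
Qed.

(** Put mu = [h.+1]. The terms 1 and X^2 of (1+X)^2 contribute C(5mu, mu) = 5 C(5mu-1, mu-1) and
    C(5mu-1, mu-1); the middle term meets an odd degree of an even series. *)
Lemma Phi1_even h : Phi (2 * h.+1) 1 = 6 * 'C(5 * h.+1 - 1, h)%:R.
Proof.
rewrite /Phi mul1r -/p mulnS add2n coef_p2 !coef_geo2; try lia.
rewrite /= oddM /= (_ : (2 * h)./2 = h); last by lia.
rewrite (_ : 2 * (2 * h).+2 + h.+1 = 5 * h.+1)%N; last by lia.
rewrite (_ : 2 * (2 * h).+2 + h = 5 * h.+1 - 1)%N; last by lia.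
rewrite -!(@bin_sub _ (2 * _)%N); try lia.
rewrite (_ : 5 * h.+1 - 2 * (2 * h).+2 = h.+1)%N; last by lia.
rewrite (_ : 5 * h.+1 - 1 - 2 * (2 * h).+2 = h)%N; last by lia.
by rewrite bin_5h natrM; ring.
Qed.

(** Modulo X^(m+1) the factor G is c/(1-X^2), so it only raises the exponent 2m+1 in [Phi] to 2m+2
    and contributes the scalar c. *)
Lemma Phi_mul_inv m A G c : eqX m.+1 ((1 - 'X ^+ 2) * G) c%:P ->
  Phi m (A * G) = c * (A * p ^+ 2 * geo2 m.+1 (2 * m).+1)`_m.
Proof.
move=> eG; set V := geo2 _ _; rewrite /Phi -/p -coefCM.
rewrite -(eqXMl (A * G * p ^+ 2) (@geo2S m.+1 (2 * m)) (ltnSn m)) -/V.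
have -> : A * G * p ^+ 2 * ((1 - 'X ^+ 2) * V) = A * p ^+ 2 * V * ((1 - 'X ^+ 2) * G).
  by ring.
by rewrite (eqXMl _ eG (ltnSn m)) mulrC.
Qed.

Lemma coef_sub1X2_geo2 m : (0 < m)%N ->
  ((1 - 'X ^+ 2) ^+ 2 * geo2 m.+1 (2 * m).+1)`_m =
  if odd m then 0 else 'C(2 * m + m./2 - 1, m./2)%:R.
Proof.
move=> m_gt0; have := eqXMl (1 - 'X ^+ 2) (@geo2S m.+1 (2 * m)).
rewrite mulrA -expr2 => /(_ m (ltnSn m)) ->.
rewrite mulrBl mul1r coefB coefXnM coef_geo2; last by lia.
case: m m_gt0 => [|[|m]] // _.
rewrite /= coef_geo2 ?subn2 /=; last by lia.
rewrite negbK; case: (odd m); first by rewrite subrr.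
have -> : (2 * m.+2 + m./2.+1 = (2 * m.+2 + m./2).+1)%N by lia.
have E : (2 * m.+2 = (2 * m.+1).+2)%N by lia.
rewrite [in 'C(_, 2 * _)]E binS subn1 /= -E natrD addrAC subrr add0r.
rewrite -(@bin_sub _ m./2.+1); last by lia.
by congr ('C(_, _)%:R); lia.
Qed.

Lemma p4_split : p ^+ 2 * p ^+ 2 = (1 - 'X ^+ 2) ^+ 2 + 'X * (4%:P * p ^+ 2).
Proof. by rewrite /p polyC_natr; ring. Qed.

(** Since p^2 + q = 2(1-X)^2, the two values add up to a multiple of the coefficient of odd degree m
    in an even series. *)
Lemma Phi_add_odd m F G c : odd m ->
  eqX m.+1 ((1 - 'X ^+ 2) * F) c%:P -> eqX m.+1 ((1 - 'X ^+ 2) * G) c%:P ->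
  Phi m (p ^+ 2 * G) + Phi m (q * F) = 0.
Proof.
move=> om eF eG; rewrite (Phi_mul_inv _ eF) (Phi_mul_inv _ eG) -mulrDr -coefD.
rewrite -!mulrDl (_ : (p ^+ 2 + q) * p ^+ 2 = 2%:P * (1 - 'X ^+ 2) ^+ 2).
  by rewrite -mulrA coefCM coef_sub1X2_geo2 ?odd_gt0 // om !mulr0.
by rewrite polyC_natr /p /q; ring.
Qed.

(** In [p4_split] the first summand leaves an even series and contributes nothing in odd degree m;
    the second contributes a positive coefficient. *)
Lemma Phi_p2_odd m G c : odd m -> 0 < c ->
  eqX m.+1 ((1 - 'X ^+ 2) * G) c%:P -> 0 < Phi m (p ^+ 2 * G).
Proof.
move=> om c_gt0 eG; rewrite (Phi_mul_inv _ eG) pmulr_rgt0 // p4_split mulrDl coefD.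
rewrite coef_sub1X2_geo2 ?odd_gt0 // om add0r -mulrA coefXM -mulrA coefCM.
case: m om {eG} => [|[|[|m]]] //= om.
  rewrite coef0M -horner_coef0 horner_exp /p !hornerE ?addr0 ?expr1n ?mul1r.
  by rewrite coef_geo2.
have om' : odd m = false by lia.
rewrite coef_p2 !coef_geo2 /= ?om' //=; try lia.
rewrite mulr0 addr0 -natrD -natrM ltr0n muln_gt0 addn_gt0 bin_gt0.
by rewrite (_ : _ <= _)%N //; lia.
Qed.

(** Put mu = [h.+1]. The first summand of [p4_split] gives C(5mu-1, mu) = 4 C(5mu-1, mu-1). The
    second gives 4 times a coefficient of odd degree, to which only the term 2X of p^2 contributes;
    hence the 8. *)
Lemma Phi_p2_even h G c :
  eqX (2 * h.+1).+1 ((1 - 'X ^+ 2) * G) c%:P ->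
  exists t : nat, Phi (2 * h.+1) (p ^+ 2 * G) = c * (4 * 'C(5 * h.+1 - 1, h) + 8 * t)%:R.
Proof.
move=> eG; rewrite (Phi_mul_inv _ eG) p4_split mulrDl coefD.
rewrite coef_sub1X2_geo2 // (_ : odd (2 * h.+1) = false); last by lia.
rewrite -mulrA coefXM -mulrA coefCM (_ : (2 * h.+1 == 0)%N = false) //.
rewrite (_ : (2 * h.+1)./2 = h.+1); last by lia.
rewrite (_ : 2 * (2 * h.+1) + h.+1 - 1 = 5 * h.+1 - 1)%N; last by lia.
have -> : 'C(5 * h.+1 - 1, h.+1) = (4 * 'C(5 * h.+1 - 1, h))%N.
  have := mul_bin_left (5 * h.+1 - 1) h.
  rewrite (_ : 5 * h.+1 - 1 - h = h.+1 * 4)%N; last by lia.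
  by rewrite -mulnA => /eqP; rewrite eqn_pmul2l // => /eqP.
exists 'C((2 * (2 * h.+1)).+1 + h, (2 * (2 * h.+1)).+1); congr (_ * _).
rewrite natrD; congr (_ + _).
rewrite (_ : (2 * h.+1).-1 = (2 * h).+1)%N; last by lia.
case: h {eG} => [|h].
  by rewrite coef_p2_1 !coef_geo2 //= mulr1 mulr0 add0r -natrM.
rewrite (_ : (2 * h.+1).+1 = (2 * h).+3)%N; last by lia.
rewrite coef_p2 !coef_geo2; try lia.
have [-> ->] : odd (2 * h).+3 = true /\ odd (2 * h).+1 = true by lia.
have [-> ->] : odd (2 * h).+2 = false /\ (2 * h).+2./2 = h.+1 by lia.
by rewrite add0r addr0 -!natrM mulnA.
Qed.
End Values.

(** * Palindromic polynomials *)

(** A symmetric form of degree 2M. Its two building blocks are eigenvectors of the MacWilliams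
    substitution: X = (1+y)^2, Z = (1-y)^2 turns them into 4 and -4 times their values at (1,
    y^2). *)
Definition gsum M (e : nat -> rat) (X Z : {poly rat}) : {poly rat} :=
  \sum_(i < M.+1) e i *: (((X + Z) ^+ 2) ^+ (M - i) * (X ^+ 2 - 6 * X * Z + Z ^+ 2) ^+ i).

(** The vector [e] is chosen before X and Z, so that a single one serves the code, its dual and its
    shadow. *)
Definition gspan M (f : {poly rat} -> {poly rat} -> {poly rat}) :=
  exists e, forall X Z, f X Z = gsum M e X Z.

Lemma gspan_ext M f g : (forall X Z, f X Z = g X Z) -> gspan M f -> gspan M g.
Proof. by move=> eqfg [e fE]; exists e => X Z; rewrite -eqfg. Qed.

Lemma gspanD M f g : gspan M f -> gspan M g -> gspan M (fun X Z => f X Z + g X Z).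
Proof.
move=> [e fE] [e' gE]; exists (fun i => e i + e' i) => X Z.
by rewrite fE gE -big_split; apply: eq_bigr => i _; rewrite scalerDl.
Qed.

Lemma gspanZ M c f : gspan M f -> gspan M (fun X Z => c *: f X Z).
Proof.
move=> [e fE]; exists (fun i => c * e i) => X Z.
by rewrite fE scaler_sumr; apply: eq_bigr => i _; rewrite scalerA.
Qed.

Lemma gspan0 M : gspan M (fun _ _ => 0).
Proof.
exists (fun _ => 0) => X Z; rewrite /gsum big1 // => i _; exact: scale0r.
Qed.

Lemma gspan_sum M I (r : seq I) (P : pred I) (f : I -> {poly rat} -> {poly rat} -> {poly rat}) :
  (forall i, P i -> gspan M (f i)) -> gspan M (fun X Z => \sum_(i <- r | P i) f i X Z).
Proof.
move=> spf; elim: r => [|i r IHr].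
  by apply: gspan_ext (gspan0 M) => X Z; rewrite big_nil.
case Pi: (P i); last by apply: gspan_ext IHr => X Z; rewrite big_cons Pi.
by apply: gspan_ext (gspanD (spf i Pi) IHr) => X Z; rewrite big_cons Pi.
Qed.

Lemma gspan_u M f : gspan M f -> gspan M.+1 (fun X Z => (X + Z) ^+ 2 * f X Z).
Proof.
move=> [e fE]; exists (fun i => if (i <= M)%N then e i else 0) => X Z.
rewrite /gsum big_ord_recr /= ltnn scale0r addr0 fE mulr_sumr.
apply: eq_bigr => -[i /= ltiM] _; rewrite -ltnS ltiM -scalerAr mulrA -exprS.
by rewrite subSn.
Qed.

Lemma gspan_q M f : gspan M f ->
  gspan M.+1 (fun X Z => (X ^+ 2 - 6 * X * Z + Z ^+ 2) * f X Z).
Proof.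
move=> [e fE]; exists (fun i => if i is i'.+1 then e i' else 0) => X Z.
rewrite /gsum big_ord_recl /= scale0r add0r fE mulr_sumr.
by apply: eq_bigr => i _; rewrite /bump /= add1n -scalerAr mulrCA -exprS.
Qed.

Lemma gspan_mul M f : gspan M f -> gspan M.+1 (fun X Z => X * Z * f X Z).
Proof.
move=> sf; have su := gspanZ 8%:R^-1 (gspan_u sf).
apply: gspan_ext (gspanD su (gspanZ (- 8%:R^-1) (gspan_q sf))) => X Z.
rewrite scaleNr -scalerBr -mulrBl.
have -> : (X + Z) ^+ 2 - (X ^+ 2 - 6 * X * Z + Z ^+ 2) = 8%:R *: (X * Z).
  by rewrite scaler_nat; ring.
by rewrite -scalerAl scalerA mulVf // scale1r.
Qed.

Lemma gspan_sqr M f : gspan M f -> gspan M.+1 (fun X Z => (X ^+ 2 + Z ^+ 2) * f X Z).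
Proof.
move=> sf; apply: gspan_ext (gspanD (gspan_u sf) (gspanZ (-2) (gspan_mul sf))) => X Z.
by rewrite scaleNr scaler_nat; ring.
Qed.

(** The recurrence has characteristic roots X^2 and Z^2; both the power sums and the complete sums
    in X^2, Z^2 satisfy it. *)
Lemma gspan_recur (t : nat -> {poly rat} -> {poly rat} -> {poly rat}) :
  gspan 0 (t 0%N) -> gspan 1 (t 1%N) ->
  (forall k X Z, t k.+2 X Z = (X ^+ 2 + Z ^+ 2) * t k.+1 X Z - X * Z * (X * Z * t k X Z)) ->
  forall k, gspan k (t k).
Proof.
move=> t0 t1 tS k; suff: gspan k (t k) /\ gspan k.+1 (t k.+1) by case.
elim: k => [|k [IH1 IH2]] //; split=> //.
apply: gspan_ext (gspanD (gspan_sqr IH2) (gspanZ (-1) (gspan_mul (gspan_mul IH1)))) => X Z.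
by rewrite tS scaleN1r.
Qed.

Lemma gspan1 : gspan 0 (fun _ _ => 1).
Proof. by exists (fun _ => 1) => X Z; rewrite /gsum big_ord1 !expr0 scale1r mulr1. Qed.

Lemma gspan_mulX M a f : gspan M f -> gspan (a + M) (fun X Z => (X * Z) ^+ a * f X Z).
Proof.
move=> sf; elim: a => [|a IHa]; first by apply: gspan_ext sf => X Z; rewrite mul1r.
by apply: gspan_ext (gspan_mul IHa) => X Z; rewrite exprS mulrA.
Qed.

Lemma gspan_powersum k : gspan k (fun X Z => X ^+ (2 * k) + Z ^+ (2 * k)).
Proof.
apply: (gspan_recur (t := fun k X Z => X ^+ (2 * k) + Z ^+ (2 * k))).
- by apply: gspan_ext (gspanD gspan1 gspan1).
- by apply: gspan_ext (gspan_sqr gspan1) => X Z; rewrite mulr1.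
move=> j X Z; rewrite (_ : 2 * j.+2 = 2 * j + 4)%N; last by lia.
by rewrite (_ : 2 * j.+1 = 2 * j + 2)%N; [rewrite !exprD; ring|lia].
Qed.

Lemma gspan_sym M a : (a <= 2 * M)%N ->
  gspan M (fun X Z => Z ^+ a * X ^+ (2 * M - a) + X ^+ a * Z ^+ (2 * M - a)).
Proof.
wlog leaM: a / (a <= M)%N => [IH lea|_].
  have [|ltMa] := leqP a M; first by move=> ?; apply: IH.
  have := IH (2 * M - a)%N; rewrite subKn // => /(_ _ _)/gspan_ext; apply; try lia.
  by move=> X Z; rewrite addrC [X in X + _]mulrC [X in _ + X]mulrC.
have := gspan_mulX a (gspan_powersum (M - a)); rewrite subnKC //.
apply: gspan_ext => X Z.
rewrite (_ : 2 * M - a = 2 * (M - a) + a)%N; last by lia.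
by rewrite !exprD exprMn; ring.
Qed.

Lemma gspan_quot k :
  gspan k (fun X Z => \sum_(i < k.+1) (X ^+ 2) ^+ (k - i) * (Z ^+ 2) ^+ i).
Proof.
pose t k (X Z : {poly rat}) := \sum_(i < k.+1) (X ^+ 2) ^+ (k - i) * (Z ^+ 2) ^+ i.
have tSl k' X Z : t k'.+1 X Z = X ^+ 2 * t k' X Z + (Z ^+ 2) ^+ k'.+1.
  rewrite /t big_ord_recr /= subnn mul1r mulr_sumr; congr (_ + _).
  by apply: eq_bigr => -[i /= lti] _; rewrite subSn // exprS mulrA.
have t0 X Z : t 0%N X Z = 1 by rewrite /t big_ord1 !expr0 mulr1.
apply: (gspan_recur (t := t)).
- by apply: gspan_ext gspan1 => X Z; rewrite t0.
- by apply: gspan_ext (gspan_sqr gspan1) => X Z; rewrite tSl t0 !mulr1.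
by move=> j X Z; rewrite !tSl [_ ^+ j.+2]exprS; ring.
Qed.

(** The two exponents differ by an even number, so X^2 - Z^2 divides the difference. For a at most M
    the quotient is (XZ)^a times a complete sum in X^2 and Z^2. *)
Lemma gspan_alt M a : (a <= 2 * M.+1)%N ->
  exists2 g, gspan M g & forall X Z,
  Z ^+ a * X ^+ (2 * M.+1 - a) - X ^+ a * Z ^+ (2 * M.+1 - a) = (X ^+ 2 - Z ^+ 2) * g X Z.
Proof.
wlog leaM: a / (a <= M.+1)%N => [IH lea|_].
  have [|ltMa] := leqP a M.+1; first by move=> ?; apply: IH.
  have [||g sg gE] := IH (2 * M.+1 - a)%N; try lia.
  exists (fun X Z => -1 *: g X Z); first exact: gspanZ.
  move=> X Z; rewrite -scalerAr -gE subKn // scaleN1r opprB.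
  by rewrite [X in X - _]mulrC [X in _ - X]mulrC.
case: (ltngtP a M.+1) leaM => // [ltaM|->] _; last first.
  exists (fun _ _ => 0); first exact: gspan0.
  move=> X Z; rewrite mulr0 (_ : 2 * M.+1 - M.+1 = M.+1)%N; last by lia.
  by rewrite mulrC subrr.
exists (fun X Z => (X * Z) ^+ a * \sum_(i < (M - a).+1) (X ^+ 2) ^+ (M - a - i) * (Z ^+ 2) ^+ i).
  by have := gspan_mulX a (gspan_quot (M - a)); rewrite subnKC.
move=> X Z; have := subrXX (X ^+ 2) (Z ^+ 2) (M - a).+1.
rewrite /=.
rewrite mulrCA => <-; rewrite -!exprM.
rewrite (_ : 2 * M.+1 - a = 2 * (M - a).+1 + a)%N; last by lia.
by rewrite !exprD exprMn; ring.
Qed.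

Lemma gspan_alt_sum M I (r : seq I) (P : pred I) (a : I -> nat) :
  (forall i, (a i <= 2 * M.+1)%N) ->
  exists e, forall X Z,
  \sum_(i <- r | P i) (Z ^+ a i * X ^+ (2 * M.+1 - a i) - X ^+ a i * Z ^+ (2 * M.+1 - a i))
    = (X ^+ 2 - Z ^+ 2) * gsum M e X Z.
Proof.
move=> lea; suff [g [e eE] gE] : exists2 g, gspan M g & forall X Z,
    \sum_(i <- r | P i) (Z ^+ a i * X ^+ (2 * M.+1 - a i) - X ^+ a i * Z ^+ (2 * M.+1 - a i))
    = (X ^+ 2 - Z ^+ 2) * g X Z by exists e => X Z; rewrite gE eE.
elim: r => [|i r [g sg gE]].
  by exists (fun _ _ => 0) => [|X Z]; [exact: gspan0|rewrite big_nil mulr0].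
case Pi: (P i); last by exists g => // X Z; rewrite big_cons Pi gE.
have [g' sg' g'E] := gspan_alt (lea i).
exists (fun X Z => g' X Z + g X Z); first exact: gspanD.
by move=> X Z; rewrite big_cons Pi gE g'E mulrDr.
Qed.

(** * Binary codes *)

Lemma F2_cases (a : 'F_2) : a = 0 \/ a = 1.
Proof. by case: a => -[|[|//]] lt_a; [left|right]; apply/val_inj. Qed.

Definition chi (a : 'F_2) : rat := if a == 0 then 1 else -1.

Lemma chiD a b : chi (a + b) = chi a * chi b.
Proof.
rewrite /chi; case: (F2_cases a) => ->; case: (F2_cases b) => -> /=;
  by rewrite ?mulrNN ?mulr1 ?mul1r.
Qed.

Lemma chi_sum I (r : seq I) (P : pred I) F :
  chi (\sum_(i <- r | P i) F i) = \prod_(i <- r | P i) chi (F i).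
Proof. by apply: (big_morph chi chiD). Qed.

Lemma wtE n (x : 'rV['F_2]_n) : wt x = (\sum_i (x 0%R i != 0%R))%N.
Proof. by rewrite /wt -sum1dep_card big_mkcond /=; apply: eq_bigr => i _; case: ifP. Qed.

(** The sum factors over the coordinates, each giving 1 - X or 1 + X according to the entry of c. *)
Lemma character_genfun n (c : 'rV['F_2]_n) :
  \sum_v chi (dotF2 c v) *: 'X^(wt v) =
  (1 - 'X) ^+ wt c * (1 + 'X) ^+ (n - wt c) :> {poly rat}.
Proof.
transitivity (\prod_(i < n) \sum_(a : 'F_2) chi (c 0 i * a) *: ('X^(a != 0) : {poly rat})).
  rewrite bigA_distr_bigA /=.
  rewrite (reindex (fun f : {ffun 'I_n -> 'F_2} => \row_i f i)) /=; last first.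
    exists (fun v : 'rV_n => [ffun i => v 0 i]) => x _.
      by apply/ffunP => i; rewrite ffunE mxE.
    by apply/rowP => i; rewrite mxE ffunE.
  apply: eq_bigr => f _; rewrite /dotF2 chi_sum wtE scaler_prod prodrXr.
  by congr (_ *: 'X^_); [apply: eq_bigr|apply: eq_bigr] => i _; rewrite mxE.
have -> : (1 - 'X) ^+ wt c * (1 + 'X) ^+ (n - wt c) =
    \prod_(i < n) (if c 0 i != 0 then 1 - 'X else 1 + 'X) :> {poly rat}.
  rewrite (bigID (fun i => c 0 i != 0)) /=; congr (_ * _).
    rewrite (eq_bigr (fun _ => 1 - 'X)) => [|i -> //].
    by rewrite prodr_const /wt cardsE.
  rewrite (eq_bigr (fun _ => 1 + 'X)); last by move=> i /negPf ->.
  rewrite prodr_const; congr (_ ^+ _).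
  have := cardsC [set i | c 0 i != 0]; rewrite -/(wt c) card_ord.
  rewrite (_ : #|~: _| = #|fun i => ~~ (c 0 i != 0)|) => [H|].
    by apply/eqP; rewrite -(eqn_add2l (wt c)) H subnKC // -[X in (_ <= X)%N]card_ord max_card.
  by apply: eq_card => i; rewrite !inE.
apply: eq_bigr => i _; rewrite (bigD1 0) //= (bigD1 1) //= big1 ?addr0.
  rewrite mulr0 mulr1 /chi; case: (F2_cases (c 0 i)) => -> /=.
    by rewrite !scale1r expr0 expr1.
  by rewrite scale1r scaleN1r expr0 expr1.
by move=> a; case: (F2_cases a) => ->.
Qed.

Section Words.
Variable n : nat.

Lemma addF2 (x : 'rV['F_2]_n) : x + x = 0.
Proof. by apply/rowP => i; rewrite !mxE; case: (F2_cases (x 0 i)) => ->; apply/val_inj. Qed.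

Lemma dotDl (x y z : 'rV['F_2]_n) : dotF2 (x + y) z = dotF2 x z + dotF2 y z.
Proof. by rewrite -big_split; apply: eq_bigr => i _; rewrite mxE mulrDl. Qed.

Lemma wt_eq0 (x : 'rV['F_2]_n) : (wt x == 0)%N = (x == 0).
Proof.
rewrite /wt cards_eq0; apply/eqP/eqP => [/setP xE|->].
  by apply/rowP => i; have := xE i; rewrite !inE mxE => /negbFE/eqP.
by apply/setP => i; rewrite !inE mxE eqxx.
Qed.

Lemma wt_le (x : 'rV['F_2]_n) : (wt x <= n)%N.
Proof. by rewrite -[X in (_ <= X)%N]card_ord max_card. Qed.

Definition overlap (x y : 'rV['F_2]_n) : nat :=
  (\sum_i ((x 0%R i != 0%R) && (y 0%R i != 0%R)))%N.

Lemma natF2 k : (k%:R : 'F_2) = (odd k)%:R.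
Proof.
rewrite -{1}(odd_double_half k) natrD -muln2 natrM.
by rewrite (_ : 2%:R = 0 :> 'F_2) ?mulr0 ?addr0 //; apply/val_inj.
Qed.

Lemma dot_overlap (x y : 'rV['F_2]_n) : dotF2 x y = (overlap x y)%:R.
Proof.
rewrite natr_sum; apply: eq_bigr => i _.
case: (F2_cases (x 0 i)) => ->; case: (F2_cases (y 0 i)) => ->; exact/val_inj.
Qed.

Lemma dot_eq0 (x y : 'rV['F_2]_n) : (dotF2 x y == 0) = ~~ odd (overlap x y).
Proof. by rewrite dot_overlap natF2; case: odd. Qed.

Lemma wtD (x y : 'rV['F_2]_n) : (wt (x + y) + 2 * overlap x y = wt x + wt y)%N.
Proof.
rewrite !wtE big_distrr -!big_split; apply: eq_bigr => i _; rewrite mxE /=.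
by case: (F2_cases (x 0 i)) => ->; case: (F2_cases (y 0 i)) => ->.
Qed.

Lemma overlapxx (x : 'rV['F_2]_n) : overlap x x = wt x.
Proof. by rewrite wtE; apply: eq_bigr => i _; rewrite andbb. Qed.

Lemma dotDr (x y z : 'rV['F_2]_n) : dotF2 x (y + z) = dotF2 x y + dotF2 x z.
Proof. by rewrite -big_split; apply: eq_bigr => i _; rewrite mxE mulrDr. Qed.

Lemma wt_compl (x : 'rV['F_2]_n) : wt (x + const_mx 1) = (n - wt x)%N.
Proof.
have W1 : wt (const_mx 1 : 'rV['F_2]_n) = n.
  by rewrite wtE (eq_bigr (fun _ => 1%N)) ?sum1_card ?card_ord // => i _; rewrite mxE.
have := wtD x (const_mx 1); rewrite W1 (_ : overlap _ _ = wt x); first by lia.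
by rewrite wtE; apply: eq_bigr => i _; rewrite mxE andbT.
Qed.

End Words.

Section Codes.
Variables (n : nat) (E : {set 'rV['F_2]_n}).
Hypothesis E0 : 0 \in E.
Hypothesis ED : {in E &, forall x y, x + y \in E}.

(** Orthogonality of characters: translation by a word [c0] with psi(c0) distinct from 1 permutes
    [E] and multiplies the sum by psi(c0). *)
Lemma character_sum (psi : 'rV['F_2]_n -> rat) :
  {in E &, forall x y, psi (x + y) = psi x * psi y} ->
  \sum_(c in E) psi c = if [forall c in E, psi c == 1] then #|E|%:R else 0.
Proof.
move=> psiD; case: ifP => [/forall_inP psi1|/negbT].
  by rewrite (eq_bigr (fun _ => 1)) ?sumr_const // => c /psi1/eqP.
rewrite negb_forall => /existsP[c0]; rewrite negb_imply => /andP[Ec0 psi1].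
have: \sum_(c in E) psi c = psi c0 * \sum_(c in E) psi c.
  rewrite {1}(reindex_onto (fun c => c + c0) (fun c => c + c0)) /=; last first.
    by move=> c _; rewrite -addrA addF2 addr0.
  have Ec c : (c + c0 \in E) = (c \in E).
    by apply/idP/idP => Ec; [rewrite -[c]addr0 -(addF2 c0) addrA|]; apply: ED.
  rewrite mulr_sumr; apply: eq_big => [c|c /andP[]].
    by rewrite Ec -addrA addF2 addr0 eqxx andbT.
  by rewrite Ec => ? _; rewrite psiD // mulrC.
move/eqP; rewrite -subr_eq0 -{1}[\sum_(c in E) _]mul1r -mulrBl mulf_eq0.
by rewrite subr_eq0 eq_sym (negPf psi1) => /eqP.
Qed.

(* psi = 1 gives the dual of E, and psi c = (-1)^(wt c / 2) its shadow. *)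
Definition twisted_dual (psi : 'rV['F_2]_n -> rat) : {set 'rV['F_2]_n} :=
  [set v | [forall c in E, psi c * chi (dotF2 c v) == 1]].

Definition wenum (S : {set 'rV['F_2]_n}) : {poly rat} := \sum_(v in S) 'X^(wt v).

Lemma macwilliams psi : {in E &, forall x y, psi (x + y) = psi x * psi y} ->
  #|E|%:R *: wenum (twisted_dual psi) =
  \sum_(c in E) psi c *: ((1 - 'X) ^+ wt c * (1 + 'X) ^+ (n - wt c)).
Proof.
move=> psiD.
under eq_bigr => c _ do rewrite -character_genfun scaler_sumr.
rewrite exchange_big /= /wenum scaler_sumr big_mkcond /=; apply: eq_bigr => v _.
under eq_bigr => c _ do rewrite scalerA.
rewrite -scaler_suml character_sum => [|x y Ex Ey]; last first.
  by rewrite psiD // dotDl chiD mulrACA.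
by rewrite inE; case: ifP => //; rewrite scale0r.
Qed.

Lemma coef_wenum S k : (wenum S)`_k = #|[set v in S | wt v == k]|%:R.
Proof.
rewrite /wenum coef_sum -sum1dep_card natr_sum [in RHS]big_mkcondr /=.
by apply: eq_bigr => v _; rewrite coefXn eq_sym; case: ifP.
Qed.

Definition dualc := [set v | [forall c in E, dotF2 c v == 0]].

Lemma twisted_dual1 : twisted_dual (fun _ => 1) = dualc.
Proof.
apply/setP => v; rewrite !inE; apply: eq_forallb => c; congr (_ ==> _).
by rewrite mul1r /chi; case: ifP.
Qed.

(** This is [macwilliams] for trivial psi at X = 1, where only the zero word contributes. *)
Lemma card_dualc : (#|E| * #|dualc| = 2 ^ n)%N.
Proof.
have /(congr1 (fun P => P.[1])) := @macwilliams (fun _ => 1) (fun _ _ _ _ => esym (mulr1 1)).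
have wenum1 : (wenum dualc).[1] = #|dualc|%:R.
  rewrite horner_sum (eq_bigr (fun _ => 1)) ?sumr_const // => v _.
  by rewrite hornerXn expr1n.
rewrite twisted_dual1 hornerZ wenum1 horner_sum (bigD1 0) //= big1 => [|c /andP[_ c0]]; last first.
  by rewrite scale1r hornerM horner_exp !hornerE subrr expr0n wt_eq0 (negPf c0) mul0r.
have -> : wt (0 : 'rV['F_2]_n) = 0%N by apply/eqP; rewrite wt_eq0.
rewrite addr0 scale1r expr0 mul1r subn0 horner_exp !hornerE -natrM.
by rewrite -[1 + 1]/(2%:R) -natrX => /eqP; rewrite eqr_nat => /eqP.
Qed.


Hypothesis Eso : E \subset dualc.

Lemma dual_dot x v : x \in E -> v \in dualc -> dotF2 x v = 0.
Proof. by move=> Ex; rewrite inE => /forall_inP/(_ x Ex)/eqP. Qed.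

Lemma self_orth_wt x : x \in E -> wt x = (2 * (wt x)./2)%N.
Proof.
move=> Ex; have /eqP := dual_dot Ex (subsetP Eso x Ex).
by rewrite dot_eq0 overlapxx mul2n => /even_halfK.
Qed.

Definition halfsign (x : 'rV['F_2]_n) : rat := (-1) ^+ (wt x)./2.

(** Two words of a self-orthogonal code overlap in an even number of places, so half the weight is
    additive modulo 2. *)
Lemma halfsignD : {in E &, forall x y, halfsign (x + y) = halfsign x * halfsign y}.
Proof.
move=> x y Ex Ey; rewrite /halfsign -exprD.
have /eqP := dual_dot Ex (subsetP Eso y Ey); rewrite dot_eq0 => ov.
have := wtD x y; rewrite (self_orth_wt Ex) (self_orth_wt Ey) (self_orth_wt (ED Ex Ey)) => W.
by rewrite -signr_odd -[in RHS]signr_odd; congr (_ ^+ _); clear E0; lia.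
Qed.

Lemma allone_dual : const_mx 1 \in dualc.
Proof.
rewrite inE; apply/forall_inP => x Ex.
rewrite dot_eq0 (_ : overlap _ _ = wt x); first by rewrite (self_orth_wt Ex) oddM.
by rewrite wtE; apply: eq_bigr => i _; rewrite mxE andbT.
Qed.

Lemma dualcD : {in dualc &, forall x y, x + y \in dualc}.
Proof.
move=> x y Dx Dy; rewrite inE; apply/forall_inP => c Ec.
by rewrite dotDr !dual_dot // addr0.
Qed.

End Codes.

(** * Codes with large dual distance *)

Section Gsum.
Let p : {poly rat} := 1 + 'X.
Let q : {poly rat} := 1 - 6 * 'X + 'X ^+ 2.
Let U : {poly rat} := (1 + 'X) ^+ 2.
Let V : {poly rat} := (1 - 'X) ^+ 2.

Lemma gsum_1X M e :
  gsum M e 1 'X = \sum_(i < M.+1) e i *: ((p ^+ 2) ^+ (M - i) * q ^+ i).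
Proof. by apply: eq_bigr => i _; rewrite expr1n mulr1. Qed.

Lemma gsum_dual M e :
  gsum M e U V = (4 ^+ M *: gsum M (fun i => (-1) ^+ i * e i) 1 'X) \Po 'X^2.
Proof.
rewrite gsum_1X comp_polyZ raddf_sum scaler_sumr /=; apply: eq_bigr => -[i /= lti] _.
rewrite comp_polyZ comp_polyM !rmorphXn /= -/p -/q.
have pX : p \Po 'X^2 = 1 + 'X ^+ 2 by rewrite rmorphD rmorph1 /= comp_polyX.
have qX : q \Po 'X^2 = 1 - 6 * 'X ^+ 2 + ('X ^+ 2) ^+ 2.
  by rewrite rmorphD rmorphB rmorphM rmorphXn rmorph1 rmorph_nat /= comp_polyX.
rewrite pX qX.
have -> : U + V = 2 * (1 + 'X ^+ 2) by rewrite /U /V; ring.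
have -> : U ^+ 2 - 6 * U * V + V ^+ 2 = - 4 * (1 - 6 * 'X ^+ 2 + ('X ^+ 2) ^+ 2).
  by rewrite /U /V; ring.
have -> : 4 ^+ M = 4 ^+ (M - i) * 4 ^+ i :> rat by rewrite -exprD subnK.
rewrite -!mul_polyC !rmorphM !rmorphXn /= !rmorph_nat rmorphN rmorph1.
rewrite -[4]/((2 * 2)%N%:R) natrM -mulN1r !exprMn; ring.
Qed.

Lemma gsum_shadow M e :
  gsum M e U (- V) =
  \sum_(i < M.+1) (e i * (16 ^+ (M - i) * 8 ^+ i)) *: ('X^(2 * (M - i)) * (1 + 'X ^+ 4) ^+ i).
Proof.
apply: eq_bigr => i _.
have -> : (U - V) ^+ 2 = 16 * 'X ^+ 2 by rewrite /U /V; ring.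
have -> : U ^+ 2 - 6 * U * (- V) + (- V) ^+ 2 = 8 * (1 + 'X ^+ 4).
  by rewrite /U /V; ring.
rewrite -!mul_polyC !rmorphM !rmorphXn /= !rmorph_nat exprM.
by rewrite [(16 * _) ^+ _]exprMn [(8 * _) ^+ _]exprMn; ring.
Qed.

End Gsum.

(** * Weighted coefficient sums on the shadow side *)

Lemma coef_exp1X i k : ((1 + 'X) ^+ i : {poly rat})`_k = 'C(i, k)%:R.
Proof.
elim: i k => [|i IHi] k; first by rewrite coef1; case: k.
rewrite exprS mulrDl mul1r coefD coefXM !IHi; case: k => [|k] /=.
  by rewrite !bin0 addr0.
by rewrite binS natrD.
Qed.

Lemma exp1X4 i : (1 + 'X ^+ 4) ^+ i = ((1 + 'X) ^+ i : {poly rat}) \Po 'X^4.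
Proof. by rewrite rmorphXn rmorphD rmorph1 /= comp_polyX. Qed.

Lemma coef_X4 s i k : ('X^s * (1 + 'X ^+ 4) ^+ i : {poly rat})`_(s + 4 * k) = 'C(i, k)%:R.
Proof.
rewrite coefXnM ltnNge leq_addr addKn /= exp1X4 coef_comp_poly_Xn //.
by rewrite dvdn_mulr // mulKn // coef_exp1X.
Qed.

Lemma coef_X4_2 s i k : ('X^s * (1 + 'X ^+ 4) ^+ i : {poly rat})`_(s + 4 * k + 2) = 0.
Proof.
rewrite -addnA coefXnM ltnNge leq_addr addKn /= exp1X4 coef_comp_poly_Xn //.
by rewrite dvdn_addr ?dvdn_mulr.
Qed.

(** The shadow counterpart of [Phi]. With c two above the centre s + 2i of y^s (1+y^4)^i, it again
    yields C(i/2, m) up to powers of 4 for odd i, and 0 for even i. The range of l covers every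
    degree c + 4l up to the length 12m. *)
Definition Psi m c (T : {poly rat}) : rat :=
  \sum_(l < (3 * m).+1) T`_(c + 4 * l) * 'C(l + m, 2 * m)%:R.

Lemma PsiZ m c a T : Psi m c (a *: T) = a * Psi m c T.
Proof. by rewrite mulr_sumr; apply: eq_bigr => l _; rewrite coefZ mulrA. Qed.

Lemma Psi_sum m c I (r : seq I) (P : pred I) (F : I -> {poly rat}) :
  Psi m c (\sum_(i <- r | P i) F i) = \sum_(i <- r | P i) Psi m c (F i).
Proof.
rewrite exchange_big /=; apply: eq_bigr => l _.
by rewrite coef_sum mulr_suml.
Qed.

Lemma bin_central_sumr m b : (b <= 3 * m)%N ->
  \sum_(l < (3 * m).+1) 'C((2 * b).+1, b.+1 + l)%:R * 'C(l + m, 2 * m)%:R =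
  4 ^+ b / 4 ^+ m * 'C(b, m)%:R :> rat.
Proof.
move=> leb; have := @bin_central_sum b m (3 * m).+1 leb.
move/(congr1 (fun k => k%:R : rat)); rewrite !natrM !natrX natr_sum mulrAC => <-.
rewrite mulrAC mulfV ?expf_neq0 // mul1r; apply: eq_bigr => l _.
by rewrite natrM mulrC.
Qed.

Lemma Psi_odd m s i : odd i -> (i <= 3 * m)%N ->
  Psi m (s + 2 * i + 2) ('X^s * (1 + 'X ^+ 4) ^+ i) = 4 ^+ i./2 / 4 ^+ m * 'C(i./2, m)%:R.
Proof.
move=> oi lei; rewrite -bin_central_sumr; last by lia.
apply: eq_bigr => l _; congr (_ * _).
have -> : (s + 2 * i + 2 + 4 * l = s + 4 * (i./2.+1 + l))%N by lia.
by rewrite coef_X4; congr ('C(_, _)%:R); lia.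
Qed.

Lemma Psi_even m s i : ~~ odd i -> Psi m (s + 2 * i + 2) ('X^s * (1 + 'X ^+ 4) ^+ i) = 0.
Proof.
move=> oi; rewrite /Psi big1 // => l _.
have -> : (s + 2 * i + 2 + 4 * l = s + 4 * (i./2 + l) + 2)%N by lia.
by rewrite coef_X4_2 mul0r.
Qed.

Lemma Psi2_odd m s i : odd i ->
  Psi m (s + 2 * i) ('X^s * (1 + 'X ^+ 4) ^+ i)
    + Psi m (s + 2 * i + 4) ('X^s * (1 + 'X ^+ 4) ^+ i) = 0.
Proof.
move=> oi; rewrite -big_split big1 //= => l _.
have -> : (s + 2 * i + 4 * l = s + 4 * (i./2 + l) + 2)%N by lia.
have -> : (s + 2 * i + 4 + 4 * l = s + 4 * (i./2.+1 + l) + 2)%N by lia.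
by rewrite !coef_X4_2 !mul0r addr0.
Qed.

(** Pascal's rule merges neighbouring entries of the even row i = 2b into the odd row 2b+1, where
    [bin_central_sumr] applies. *)
Lemma Psi2_even m s i : ~~ odd i -> (i <= 3 * m)%N ->
  Psi m (s + 2 * i) ('X^s * (1 + 'X ^+ 4) ^+ i)
    + Psi m (s + 2 * i + 4) ('X^s * (1 + 'X ^+ 4) ^+ i) =
  4 ^+ i./2 / 4 ^+ m * 'C(i./2, m)%:R.
Proof.
move=> oi lei; rewrite -bin_central_sumr -?big_split; last by lia.
apply: eq_bigr => l _; rewrite /= -mulrDl; congr (_ * _).
have -> : (s + 2 * i + 4 * l = s + 4 * (i./2 + l))%N by lia.
have -> : (s + 2 * i + 4 + 4 * l = s + 4 * (i./2 + l).+1)%N by lia.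
rewrite !coef_X4 addSn binS natrD addrC.
by have -> : (2 * i./2 = i)%N by lia.
Qed.

(** Because 8^2 * 4 = 16^2, the scale in [gsum_shadow] times the power in [Psi_odd] is the same for
    all odd i. This makes the sums obtained through [Psi] and [Phi] proportional. *)
Lemma pow_odd M i : odd i -> (i <= M)%N ->
  16 ^+ (M - i) * 8 ^+ i * 4 ^+ i./2 = 16 ^+ M / 2 :> rat.
Proof.
move=> oi lei; rewrite -{2}(subnK lei) exprD.
have -> : i = (2 * i./2).+1 by lia.
rewrite mul2n /= uphalf_double -mul2n !exprS !exprM.
rewrite -(_ : (8 ^+ 2) ^+ i./2 * 4 ^+ i./2 = (16 ^+ 2) ^+ i./2) //; first by field.
by rewrite -exprMn; congr (_ ^+ _); rewrite -!natrX -natrM.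
Qed.

Lemma pow_even M i : ~~ odd i -> (i <= M)%N ->
  16 ^+ (M - i) * 8 ^+ i * 4 ^+ i./2 = 16 ^+ M :> rat.
Proof.
move=> oi lei; rewrite -{2}(subnK lei) exprD -mulrA; congr (_ * _).
have -> : i = (2 * i./2)%N by lia.
rewrite (_ : (2 * i./2)./2 = i./2); last by lia.
rewrite !exprM -exprMn; congr (_ ^+ _).
Qed.

Lemma coef_compNX (p : {poly rat}) k : (p \Po (- 'X))`_k = (-1) ^+ k * p`_k.
Proof.
rewrite comp_polyE coef_sum.
under eq_bigr => i _ do rewrite exprNn -polyC1 -polyCN -rmorphXn /= mul_polyC !coefZ coefXn.
have [ltk|lek] := ltnP k (size p).
  rewrite (bigD1 (Ordinal ltk)) //= eqxx mulr1 big1 ?addr0 1?mulrC // => i.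
  by rewrite -val_eqE /= eq_sym => /negPf ->; rewrite !mulr0.
rewrite big1 ?nth_default ?mulr0 // => -[i /= lti] _.
by rewrite (gtn_eqF (leq_trans lti lek)) !mulr0.
Qed.

(** * Comparison of a code with its dual and its shadow *)

Section Core.
Variables (m : nat) (E : {set 'rV['F_2]_(12 * m)}).
Hypothesis m_gt0 : (0 < m)%N.
Hypothesis E0 : 0 \in E.
Hypothesis ED : {in E &, forall x y, x + y \in E}.
Hypothesis Eso : E \subset dualc E.
Hypothesis Dmin : forall v, v \in dualc E -> v != 0 -> (2 * m + 2 <= wt v)%N.

Let J : 'rV['F_2]_(12 * m) := const_mx 1.
Let N := (2 * (3 * m))%N.
Let U : {poly rat} := (1 + 'X) ^+ 2.
Let V : {poly rat} := (1 - 'X) ^+ 2.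

(* The weight enumerator of E in the squares X, Z of the two variables, plus eps
   times its image under the exchange of X and Z. *)
Definition pe (eps : rat) (X Z : {poly rat}) : {poly rat} :=
  \sum_(c in E) (Z ^+ (wt c)./2 * X ^+ (N - (wt c)./2)
                 + eps *: (X ^+ (wt c)./2 * Z ^+ (N - (wt c)./2))).

Lemma wt_half_le (c : 'rV['F_2]_(12 * m)) : ((wt c)./2 <= N)%N.
Proof. by have := wt_le c; rewrite /N; lia. Qed.

Lemma wt0 : wt (0 : 'rV['F_2]_(12 * m)) = 0%N.
Proof. by apply/eqP; rewrite wt_eq0. Qed.

(** By [Dmin] only the zero word contributes to the first half. In the exchanged half a low degree
    means that c + J is light; as c + J lies in the dual, [Dmin] forces c = J. *)
Lemma pe_low eps : eqX m.+1 (pe eps 1 'X) (1 + eps * (J \in E)%:R)%:P.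
Proof.
move=> k ltk; rewrite coef_sum coefC.
have S1 : \sum_(c in E) (k == (wt c)./2)%:R = (k == 0)%N%:R :> rat.
  rewrite (bigD1 0) //= wt0 big1 ?addr0 // => c /andP[Ec c0].
  have W := Dmin (subsetP Eso c Ec) c0.
  by rewrite ltn_eqF //; lia.
have S2 : \sum_(c in E) (k == (N - (wt c)./2)%N)%:R = (k == 0)%N%:R * (J \in E)%:R :> rat.
  have cJ c : c \in E -> c != J -> k == (N - (wt c)./2)%N = false.
    move=> Ec cJ; have := dualcD (subsetP Eso c Ec) (allone_dual Eso).
    move=> /Dmin; rewrite wt_compl.
    have -> : c + const_mx 1 != 0.
      by apply: contraNneq cJ => cJ0; rewrite -[c]addr0 -(addF2 J) addrA cJ0 add0r.
    by move/(_ isT); have := wt_le c; have := self_orth_wt Eso Ec; rewrite /N; lia.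
  case JE: (J \in E); last first.
    by rewrite mulr0 big1 // => c Ec; rewrite cJ //; apply: contraFneq JE => <-.
  rewrite (bigD1 J) //= big1 ?addr0 ?mulr1; last by move=> c /andP[Ec /(cJ _ Ec) ->].
  have -> : wt J = (12 * m)%N.
    by have := wt_compl (0 : 'rV['F_2]_(12 * m)); rewrite add0r wt0 subn0.
  by rewrite (_ : N - _ = 0)%N // /N; lia.
rewrite (_ : \sum_(i in E) _ = \sum_(c in E) (k == (wt c)./2)%:R
     + eps * \sum_(c in E) (k == (N - (wt c)./2)%N)%:R); last first.
  rewrite mulr_sumr -big_split; apply: eq_bigr => c _.
  by rewrite !expr1n mulr1 mul1r coefD coefZ !coefXn.
by rewrite S1 S2; case: eqP => _ //=; rewrite ?mul1r ?mul0r ?mulr0 ?addr0.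
Qed.

(** Exchanging U and V amounts to y -> -y, so eps = 1 selects the even weights and eps = -1 the odd
    ones. The dual is obtained for sg = 1, the shadow for sg = -1. *)
Lemma pe_macwilliams eps (sg : rat) k : sg ^+ 2 = 1 ->
  {in E &, forall x y, sg ^+ (wt (x + y))./2 = sg ^+ (wt x)./2 * sg ^+ (wt y)./2} ->
  (pe eps U (sg *: V))`_k = #|E|%:R * (1 + eps * (-1) ^+ k)
     * (wenum (twisted_dual E (fun c => sg ^+ (wt c)./2)))`_k.
Proof.
move=> sg2 sgD; have /(congr1 (fun P => P + eps *: (P \Po - 'X))) := macwilliams ED sgD.
move/(congr1 (fun P : {poly rat} => P`_k)).
rewrite coefD [X in X + _]coefZ [X in _ + X]coefZ coef_compNX [in X in _ * (_ * X)]coefZ => H.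
have -> : #|E|%:R * (1 + eps * (-1) ^+ k) * (wenum (twisted_dual E (fun c => sg ^+ (wt c)./2)))`_k
  = #|E|%:R * (wenum (twisted_dual E (fun c => sg ^+ (wt c)./2)))`_k +
    eps * ((-1) ^+ k * (#|E|%:R * (wenum (twisted_dual E (fun c => sg ^+ (wt c)./2)))`_k)).
  by ring.
rewrite H; congr ((polyseq _)`__).
rewrite raddf_sum scaler_sumr -big_split; apply: eq_bigr => c Ec /=.
rewrite comp_polyZ scalerA [eps * _]mulrC -scalerA -scalerDr.
have W := self_orth_wt Eso Ec.
have -> : (12 * m - wt c = 2 * (N - (wt c)./2))%N by have := wt_le c; rewrite /N; lia.
rewrite [in (1 - 'X) ^+ wt c]W.
have -> : ((1 - 'X) ^+ (2 * (wt c)./2) * (1 + 'X) ^+ (2 * (N - (wt c)./2))) \Po - 'X =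
          U ^+ (wt c)./2 * V ^+ (N - (wt c)./2).
  rewrite rmorphM !rmorphXn rmorphB rmorphD rmorph1 /= comp_polyX opprK !exprM.
  by [].
rewrite !exprZn -/V !exprM -/U -/V.
(* N is even and [sg] squares to 1. *)
have -> : sg ^+ (N - (wt c)./2) = sg ^+ (wt c)./2.
  have := wt_half_le c; rewrite /N; set a := (wt c)./2 => lea.
  have E1 : sg ^+ a * sg ^+ (2 * (3 * m) - a) = 1.
    by rewrite -exprD subnKC // exprM sg2 expr1n.
  have E2 : sg ^+ a * sg ^+ a = 1 by rewrite -expr2 exprAC sg2 expr1n.
  by rewrite -[LHS]mul1r -E2 -mulrA E1 mulr1.
by rewrite -scalerAl -scalerAr scalerDr !scalerA [eps * _]mulrC.
Qed.


Let p : {poly rat} := 1 + 'X.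
Let q : {poly rat} := 1 - 6 * 'X + 'X ^+ 2.
Let S := twisted_dual E (@halfsign _).

Lemma pe_dual eps k : (k < 2 * m + 2)%N ->
  (pe eps U V)`_k = #|E|%:R * (1 + eps * (-1) ^+ k) * (k == 0)%N%:R.
Proof.
move=> ltk; rewrite -[V]scale1r pe_macwilliams ?expr1n //; last first.
  by move=> x y _ _; rewrite !expr1n mulr1.
congr (_ * _); rewrite coef_wenum (_ : twisted_dual _ _ = dualc E); last first.
  rewrite -twisted_dual1; apply/setP => v; rewrite !inE.
  by apply: eq_forallb => c; rewrite expr1n.
case: eqP => [->|/eqP k0].
  rewrite (_ : [set v in _ | _] = [set 0]) ?cards1 //; apply/setP => v.
  rewrite !inE wt_eq0 -[LHS]andbC; case: eqP => [->|] //=.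
  by have := subsetP Eso _ E0; rewrite inE.
rewrite (_ : [set v in _ | _] = set0) ?cards0 //; apply/setP => v.
rewrite [LHS]inE [RHS]inE; apply/negP => /andP[Dv /eqP wk].
by have := Dmin Dv; rewrite -wt_eq0 wk k0 => /(_ isT); rewrite leqNgt ltk.
Qed.

Lemma pe_shadow eps k :
  (pe eps U (- V))`_k = #|E|%:R * (1 + eps * (-1) ^+ k) * (wenum S)`_k.
Proof.
rewrite -scaleN1r; have sg2 : (-1) ^+ 2 = 1 :> rat by rewrite sqrrN expr1n.
exact: (pe_macwilliams eps k sg2 (halfsignD ED Eso)).
Qed.

Lemma Phi_odd_term i : odd i -> (i <= 3 * m)%N ->
  Phi m (p ^+ (6 * m - 2 * i) * q ^+ i) = (-16) ^+ m * 'C(i./2, m)%:R.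
Proof.
move=> oi lei; rewrite -Phi_odd //; last by lia.
congr (Phi _ _); rewrite mulrC; congr (_ ^+ _ * _ ^+ _); lia.
Qed.

Lemma sum_odd_part M (F : nat -> {poly rat}) :
  \sum_(i < M.+1) F i - \sum_(i < M.+1) (-1) ^+ i *: F i =
  2 *: \sum_(i < M.+1 | odd i) F i.
Proof.
rewrite scaler_sumr [RHS]big_mkcond -sumrB; apply: eq_bigr => i _.
rewrite -signr_odd; case: (odd i); last by rewrite scale1r subrr.
by rewrite expr1 scaleN1r opprK scaler_nat mulr2n.
Qed.

Lemma sum_even_part M (F : nat -> {poly rat}) :
  \sum_(i < M.+1) F i + \sum_(i < M.+1) (-1) ^+ i *: F i =
  2 *: \sum_(i < M.+1 | ~~ odd i) F i.
Proof.
rewrite scaler_sumr [RHS]big_mkcond -big_split; apply: eq_bigr => i _ /=.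
rewrite -signr_odd; case: (odd i); first by rewrite expr1 scaleN1r subrr.
by rewrite scale1r scaler_nat mulr2n.
Qed.

Lemma main_identity :
  ((1 + (J \in E)%:R) * 64 ^+ m - 2 * #|E|%:R) * Phi m 1 =
  8 * (-1) ^+ m * #|E|%:R * Psi m (6 * m + 2) (wenum S).
Proof.
have [e eE] : gspan (3 * m) (pe 1).
  apply: gspan_sum => c _; apply: gspan_ext (gspan_sym (wt_half_le c)) => X Z.
  by rewrite scale1r.
pose Q : rat := \sum_(i < (3 * m).+1 | odd i) e i * 'C(i./2, m)%:R.
have H1 : eqX m.+1 (gsum (3 * m) e 1 'X) (1 + (J \in E)%:R)%:P.
  by have := pe_low 1; rewrite eE mul1r.
(* The factor 2 is 1 + eps at degree 0, and 64^m = 4^(3m) is the scale in [gsum_dual]. *)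
have H2 : eqX m.+1 (gsum (3 * m) (fun i => (-1) ^+ i * e i) 1 'X) (2 * #|E|%:R / 64 ^+ m)%:P.
  move=> k ltk; have ltk2 : (2 * k < 2 * m + 2)%N by lia.
  have := pe_dual 1 ltk2; rewrite eE gsum_dual coef_comp_poly_Xn // dvdn_mulr //.
  rewrite mulKn // coefZ coefC [(-1) ^+ _]exprM sqrrN !expr1n mul1r => H.
  have e64 : 4 ^+ (3 * m) = 64 ^+ m :> rat by rewrite exprM -natrX.
  rewrite e64 in H; apply: (mulfI (_ : 64 ^+ m != 0)); first by rewrite expf_neq0.
  rewrite H muln_eq0 /=; case: eqP => _; last by rewrite !mulr0.
  by rewrite [64 ^+ m * _]mulrC divfK ?expf_neq0 // mulr1 mulrC.
(* Both forms are constants modulo X^(m+1); their difference keeps twice the terms with odd i, whose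
   [Phi]-values add up to a multiple of [Q]. *)
have HPhi : ((1 + (J \in E)%:R) - 2 * #|E|%:R / 64 ^+ m) * Phi m 1 = 2 * ((-16) ^+ m * Q).
  have -> : ((1 + (J \in E)%:R) - 2 * #|E|%:R / 64 ^+ m) * Phi m 1 =
      Phi m (gsum (3 * m) e 1 'X - gsum (3 * m) (fun i => (-1) ^+ i * e i) 1 'X).
    rewrite PhiD -scaleN1r PhiZ (Phi_eqX H1) (Phi_eqX H2).
    by rewrite -!alg_polyC !PhiZ mulN1r mulrBl.
  rewrite !gsum_1X.
  under [X in _ - X]eq_bigr => i _ do rewrite -scalerA.
  rewrite -/p -/q (sum_odd_part _ (fun i => e i *: ((p ^+ 2) ^+ (3 * m - i) * q ^+ i))).
  rewrite PhiZ; congr (_ * _); rewrite Phi_sum mulr_sumr.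
  apply: eq_bigr => -[i /= lti] oi; rewrite PhiZ -exprM.
  rewrite (_ : 2 * (3 * m - i) = 6 * m - 2 * i)%N; last by lia.
  by rewrite Phi_odd_term // mulrCA.
(* The same [Q] computed from the shadow: all sampled degrees are even, and the terms with even i
   vanish under [Psi]. *)
have HPsi : 2 * #|E|%:R * Psi m (6 * m + 2) (wenum S) = 16 ^+ (3 * m) / 2 / 4 ^+ m * Q.
  have -> : 2 * #|E|%:R * Psi m (6 * m + 2) (wenum S) = Psi m (6 * m + 2) (pe 1 U (- V)).
    rewrite /Psi mulr_sumr; apply: eq_bigr => l _; rewrite pe_shadow.
    by rewrite -signr_odd (_ : odd _ = false) ?expr0; [ring|lia].
  rewrite eE gsum_shadow Psi_sum (bigID (fun i : 'I_ _ => odd i)) /= [X in _ + X]big1 ?addr0.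
    rewrite mulr_sumr; apply: eq_bigr => -[i /= lti] oi.
    rewrite PsiZ (_ : 6 * m + 2 = 2 * (3 * m - i) + 2 * i + 2)%N; last by lia.
    by rewrite Psi_odd // -(pow_odd oi (lti : (i <= 3 * m)%N)); ring.
  move=> [i /= lti] oi.
  rewrite PsiZ (_ : 6 * m + 2 = 2 * (3 * m - i) + 2 * i + 2)%N; last by lia.
  by rewrite Psi_even // mulr0.
have -> : ((1 + (J \in E)%:R) * 64 ^+ m - 2 * #|E|%:R) * Phi m 1 = 64 ^+ m * (2 * ((-16) ^+ m * Q)).
  rewrite -HPhi mulrA; congr (_ * _); field; exact: expf_neq0.
have -> : 8 * (-1) ^+ m * #|E|%:R * Psi m (6 * m + 2) (wenum S) =
   4 * (-1) ^+ m * (2 * #|E|%:R * Psi m (6 * m + 2) (wenum S)) by ring.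
rewrite HPsi exprM.
have -> : (16 ^+ 3) ^+ m = 4 ^+ m * 16 ^+ m * 64 ^+ m :> rat.
  by rewrite -!exprMn; congr (_ ^+ _); rewrite -natrX -!natrM.
have -> : (-16) ^+ m = (-1) ^+ m * 16 ^+ m :> rat by rewrite -exprMn mulN1r.
field; exact: expf_neq0.
Qed.


Lemma coef_wenum_shadow k : (wenum S)`_k \is a Num.nat.
Proof. by rewrite coef_wenum natr_nat. Qed.

(** * Words of odd weight, when J is not in E and the left side of [main_identity] is zero *)

Section OddWords.
Hypothesis JE : J \notin E.
Hypothesis cardE : (2 * #|E|)%:R = 64 ^+ m :> rat.

(** The form [pe (-1)] is X^2 - Z^2 times a symmetric form of degree 2(3m-1); F and G are the parts
    of the latter with even and odd i. R is its rescaled shadow image, so that the odd part of the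
    shadow enumerator is y(1+y^2)R. The last two equations compare [Psi] with [Phi] on each part. *)
Lemma odd_part_identities :
  exists F G R : {poly rat},
  [/\ eqX m.+1 ((1 - 'X ^+ 2) * F) (2^-1)%:P, eqX m.+1 ((1 - 'X ^+ 2) * G) (2^-1)%:P,
      forall w, ~~ odd w -> (wenum S)`_(w + 3) = R`_(w + 2) + R`_w,
      Psi m (6 * m) R = 4^-1 * (-1) ^+ m * Phi m (p ^+ 2 * G)
    & Psi m (6 * m - 2) R + Psi m (6 * m + 2) R = 2^-1 * (-1) ^+ m * Phi m (q * F)].
Proof.
have [M M3] : exists M, (3 * m = M.+1)%N by exists (3 * m).-1; lia.
have [e eE] : exists e, forall X Z, pe (-1) X Z = (X ^+ 2 - Z ^+ 2) * gsum M e X Z.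
  have lea c : ((wt (c : 'rV['F_2]_(12 * m)))./2 <= 2 * M.+1)%N by rewrite -M3 wt_half_le.
  have [e eE] := gspan_alt_sum (index_enum _) (mem E) lea.
  exists e => X Z; rewrite -eE; apply: eq_bigr => c _.
  by rewrite scaleN1r /N M3.
pose t i := e i *: ((p ^+ 2) ^+ (M - i) * q ^+ i).
pose F := \sum_(i < M.+1 | ~~ odd i) t i; pose G := \sum_(i < M.+1 | odd i) t i.
pose H1 := gsum M e 1 'X; pose H2 := gsum M (fun i => (-1) ^+ i * e i) 1 'X.
have H1E : H1 = \sum_(i < M.+1) t i by rewrite /H1 gsum_1X.
have H2E : H2 = \sum_(i < M.+1) (-1) ^+ i *: t i.
  by rewrite /H2 gsum_1X; apply: eq_bigr => i _; rewrite scalerA.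
have L1 : eqX m.+1 ((1 - 'X ^+ 2) * H1) 1.
  by have := pe_low (-1); rewrite eE expr1n (negPf JE) mulr0 addr0 polyC1.
have pX : p \Po 'X^2 = 1 + 'X ^+ 2 by rewrite rmorphD rmorph1 /= comp_polyX.
have UV : U ^+ 2 - V ^+ 2 = 8%:P * ('X * (p \Po 'X^2)).
  by rewrite pX polyC_natr /U /V; ring.
(* The dual has no word of odd weight below 2m+2, and U^2 - V^2 = 8y(1+y^2) shifts degree 2k+1 to
   degree k of [p * H2]. *)
have L2 : eqX m.+1 ((1 - 'X ^+ 2) * H2) 0.
  have pH2 : eqX m.+1 (p * H2) 0.
    move=> k ltk; have ltk2 : ((2 * k).+1 < 2 * m + 2)%N by lia.
    have := pe_dual (-1) ltk2; rewrite mulr0 eE gsum_dual UV -!mulrA coefCM coefXM /=.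
    rewrite -comp_polyM coef_comp_poly_Xn // dvdn_mulr // mulKn // -scalerAr coefZ coef0.
    by move/eqP; rewrite !mulf_eq0 expf_eq0 /= andbF /= => /eqP.
  have -> : (1 - 'X ^+ 2) * H2 = (1 - 'X) * (p * H2) by rewrite /p; ring.
  by apply: eqX_trans (eqXMl _ pH2) _; rewrite mulr0.
have half_eqX A B : 2 *: A = B -> eqX m.+1 ((1 - 'X ^+ 2) * B) 1 ->
    eqX m.+1 ((1 - 'X ^+ 2) * A) (2^-1)%:P.
  move=> <- eB k ltk; have := eB k ltk; rewrite -scalerAr coefZ coef1 coefC => eA.
  by apply: (mulfI (_ : 2 != 0)) => //; rewrite eA; case: eqP => _; rewrite ?mulr0 ?mulfV.
have HF : eqX m.+1 ((1 - 'X ^+ 2) * F) (2^-1)%:P.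
  apply: (half_eqX _ (H1 + H2)); first by rewrite H1E H2E sum_even_part.
  by rewrite mulrDr -[X in eqX _ _ X]addr0; apply: eqXD.
have HG : eqX m.+1 ((1 - 'X ^+ 2) * G) (2^-1)%:P.
  apply: (half_eqX _ (H1 + -1 *: H2)); first by rewrite H1E H2E scaleN1r sum_odd_part.
  rewrite mulrDr -[X in eqX _ _ X]addr0; apply: eqXD => // k ltk.
  by rewrite -scalerAr coefZ L2 // coef0 mulr0.
pose T := \sum_(i < M.+1)
  (e i * (16 ^+ (M - i) * 8 ^+ i)) *: ('X^(2 * (M - i)) * (1 + 'X ^+ 4) ^+ i).
have cE_neq0 : #|E|%:R != 0 :> rat.
  by rewrite pnatr_eq0 -lt0n; apply/card_gt0P; exists 0.
pose R := (4 / #|E|%:R) *: T.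
pose QF : rat := \sum_(i < M.+1 | ~~ odd i) e i * 'C(i./2, m)%:R.
pose QG : rat := \sum_(i < M.+1 | odd i) e i * 'C(i./2, m)%:R.
have PhiG : Phi m (p ^+ 2 * G) = (-16) ^+ m * QG.
  rewrite mulr_sumr Phi_sum mulr_sumr; apply: eq_bigr => -[i /= lti] oi.
  rewrite /t -scalerAr PhiZ -exprM mulrA -exprD.
  rewrite (_ : 2 + 2 * (M - i) = 6 * m - 2 * i)%N; last by lia.
  by rewrite Phi_odd_term //; [exact: mulrCA|lia].
have PhiF : Phi m (q * F) = (-16) ^+ m * QF.
  rewrite mulr_sumr Phi_sum mulr_sumr; apply: eq_bigr => -[i /= lti] oi.
  rewrite /t -scalerAr PhiZ -exprM mulrCA -exprS.
  rewrite (_ : 2 * (M - i) = 6 * m - 2 * i.+1)%N; last by lia.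
  rewrite Phi_odd_term; [|by []|lia].
  by rewrite /= uphalf_half (negPf oi) mulrCA.
have pow4 : 4 / #|E|%:R * (16 ^+ M / 4 ^+ m) = 2^-1 * 16 ^+ m :> rat.
  have -> : #|E|%:R = 64 ^+ m / 2 :> rat by rewrite -cardE natrM; field.
  have <- : 16 ^+ M.+1 / 16 = 16 ^+ M :> rat by rewrite exprSr mulfK.
  rewrite -M3 exprM.
  have -> : (16 ^+ 3) ^+ m = 4 ^+ m * 16 ^+ m * 64 ^+ m :> rat.
    by rewrite -!exprMn; congr (_ ^+ _); rewrite -natrX -!natrM.
  by field; rewrite !expf_neq0.
have sgn16 : (-1) ^+ m * (-16) ^+ m = 16 ^+ m :> rat by rewrite -exprMn mulrNN mul1r.
exists F, G, R; split=> //.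
- move=> w ow; apply: (mulfI (_ : #|E|%:R * 2 != 0)); first by rewrite mulf_neq0.
  have := pe_shadow (-1) (w + 3); rewrite -signr_odd oddD (negPf ow) /= expr1 mulN1r opprK => <-.
  rewrite eE gsum_shadow sqrrN UV -/T.
  have -> : 8%:P * ('X * (p \Po 'X^2)) * T = (#|E|%:R * 2) *: ('X * (R + 'X^2 * R)).
    rewrite /R -scalerAr -scalerDr -scalerAr scalerA.
    rewrite (_ : #|E|%:R * 2 * (4 / #|E|%:R) = 8); last by field.
    by rewrite -mul_polyC pX; ring.
  by rewrite coefZ coefXM addn3 /= coefD coefXnM /= addn2 subn2.
- rewrite PhiG -mulrA [in RHS](mulrA ((-1) ^+ m)) sgn16.
  rewrite /R PsiZ /T Psi_sum (bigID (fun i : 'I_ _ => odd i)) /= [X in _ + X]big1 ?addr0.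
    transitivity (2^-1 * (4 / #|E|%:R * (16 ^+ M / 4 ^+ m)) * QG); last first.
      by rewrite pow4; field.
    rewrite !mulr_sumr; apply: eq_bigr => -[i /= lti] oi.
    rewrite PsiZ (_ : 6 * m = 2 * (M - i) + 2 * i + 2)%N; last by lia.
    rewrite Psi_odd //; last by lia.
    transitivity (4 / #|E|%:R *
      (e i * (16 ^+ (M - i) * 8 ^+ i * 4 ^+ i./2) / 4 ^+ m * 'C(i./2, m)%:R)).
      by ring.
    by rewrite pow_odd //; ring.
  move=> [i /= lti] oi.
  rewrite PsiZ (_ : 6 * m = 2 * (M - i) + 2 * i + 2)%N; last by lia.
  by rewrite Psi_even // mulr0.
rewrite PhiF -mulrA [in RHS](mulrA ((-1) ^+ m)) sgn16 mulrA -pow4.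
rewrite /R !PsiZ /T !Psi_sum -mulrDr -big_split /=.
rewrite (bigID (fun i : 'I_ _ => odd i)) /= big1 ?add0r.
  rewrite !mulr_sumr; apply: eq_bigr => -[i /= lti] oi.
  rewrite !PsiZ -mulrDr (_ : 6 * m - 2 = 2 * (M - i) + 2 * i)%N; last by lia.
  rewrite (_ : 6 * m + 2 = 2 * (M - i) + 2 * i + 4)%N; last by lia.
  rewrite Psi2_even //; last by lia.
  transitivity (4 / #|E|%:R *
      (e i * (16 ^+ (M - i) * 8 ^+ i * 4 ^+ i./2) / 4 ^+ m * 'C(i./2, m)%:R)).
    by ring.
  by rewrite pow_even //; ring.
move=> [i /= lti] oi.
rewrite !PsiZ -mulrDr (_ : 6 * m - 2 = 2 * (M - i) + 2 * i)%N; last by lia.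
rewrite (_ : 6 * m + 2 = 2 * (M - i) + 2 * i + 4)%N; last by lia.
by rewrite Psi2_odd // mulr0.
Qed.


(** By [Phi_add_odd] a nonnegative combination of odd shadow coefficients is zero. So these vanish
    above degree 10m, hence R does too in even degrees, against the positivity in [Phi_p2_odd]. *)
Lemma no_odd_words_odd : odd m -> False.
Proof.
move=> om; have [F [G [R [HF HG RS PG PF]]]] := odd_part_identities.
have Phi0 := Phi_add_odd om HF HG.
have Phi_gt0 := Phi_p2_odd om (isT : 0 < 2^-1 :> rat) HG.
have sgn : (-1) ^+ m = -1 :> rat by rewrite -signr_odd om expr1.
rewrite sgn -/p -/q in PG PF Phi0 Phi_gt0.
have s_ge0 k : 0 <= (wenum S)`_k by rewrite coef_wenum ler0n.
have: \sum_(l < (3 * m).+1) ((wenum S)`_(6 * m + 4 * l + 1)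
    + (wenum S)`_(6 * m + 4 * l + 3)) * 'C(l + m, 2 * m)%:R = 0.
  transitivity (2 * Psi m (6 * m) R + (Psi m (6 * m - 2) R + Psi m (6 * m + 2) R)).
    rewrite mulr_sumr -!big_split; apply: eq_bigr => l _ /=.
    rewrite (_ : 6 * m + 4 * l + 1 = (6 * m - 2 + 4 * l) + 3)%N; last by lia.
    rewrite !RS; try lia.
    rewrite (_ : 6 * m - 2 + 4 * l + 2 = 6 * m + 4 * l)%N; last by lia.
    rewrite (_ : 6 * m + 4 * l + 2 = 6 * m + 2 + 4 * l)%N; last by lia.
    by ring.
  by rewrite PG PF; move: Phi0 => /eqP; rewrite addr_eq0 => /eqP ->; field.
move=> /eqP; rewrite psumr_eq0 => [/allP s0|l _]; last by rewrite mulr_ge0 ?addr_ge0.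
(* The weight C(l+m, 2m) is nonzero from l = m on, that is from degree 6m + 4m. *)
have sz k : odd k -> (10 * m < k)%N -> (wenum S)`_k = 0.
  move=> ok ltk; have [ltmk|lekm] := ltnP (12 * m) k.
    rewrite coef_wenum (_ : [set v in _ | _] = set0) ?cards0 //.
    apply/setP => v; rewrite [LHS]inE [RHS]inE; apply/negP => /andP[_ /eqP wk].
    by have := wt_le v; rewrite wk leqNgt ltmk.
  have ltl : ((k - 6 * m) %/ 4 < (3 * m).+1)%N by lia.
  have := s0 (Ordinal ltl) (mem_index_enum _); rewrite /= mulf_eq0 pnatr_eq0.
  rewrite -leqn0 leqNgt bin_gt0 (_ : 2 * m <= _)%N //=; last by lia.
  rewrite orbF paddr_eq0 // => /andP[/eqP s1 /eqP s3].
  have [E1|E3] : (k = 6 * m + 4 * ((k - 6 * m) %/ 4) + 1 \/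
             k = 6 * m + 4 * ((k - 6 * m) %/ 4) + 3)%N by lia.
    by rewrite E1.
  by rewrite E3.
(* Descending recursion from the size of R, with j bounding the number of steps of 2. *)
have Rz j w : (size R <= w + 2 * j)%N -> ~~ odd w -> (10 * m <= w)%N -> R`_w = 0.
  elim: j w => [|j IHj] w szR ow lew; first by rewrite nth_default //; move: szR; rewrite addn0.
  have sz3 : (wenum S)`_(w + 3) = 0 by apply: sz; lia.
  have R2 : R`_(w + 2) = 0 by apply: IHj; move: szR; lia.
  by have := RS w ow; rewrite sz3 R2 add0r.
have PG0 : Psi m (6 * m) R = 0.
  rewrite /Psi big1 // => l _; have [ltlm|leml] := ltnP l m.
    by rewrite bin_small ?mulr0 //; lia.
  by rewrite (Rz (size R)) ?mul0r //; lia.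
by move: PG; rewrite PG0; lra.
Qed.

(** Descending recursion shows that R has integer coefficients in even degrees, so [Psi m (6 * m) R]
    is an integer. By [Phi_p2_even] it equals C(5h+4, h)/2 plus an integer, with an odd binomial. *)
Lemma no_odd_words_even h : m = (2 * h.+1)%N -> odd 'C(5 * h.+1 - 1, h) -> False.
Proof.
move=> mE oX; have [F [G [R [HF HG RS PG PF]]]] := odd_part_identities.
have Rint j w : (size R <= w + 2 * j)%N -> ~~ odd w -> R`_w \is a Num.int.
  elim: j w => [|j IHj] w szR ow; first by rewrite nth_default //; move: szR; rewrite addn0.
  have -> : R`_w = (wenum S)`_(w + 3) - R`_(w + 2) by rewrite RS // addrAC subrr add0r.
  rewrite rpredB ?IHj //; [|move: szR; lia|lia].
  by rewrite coef_wenum rpred_nat.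
have : Psi m (6 * m) R \is a Num.int.
  rewrite rpred_sum // => l _; rewrite rpredM ?rpred_nat // (Rint (size R)) //; lia.
have [t tE] : exists t : nat, Phi m (p ^+ 2 * G) = 2^-1 * (4 * 'C(5 * h.+1 - 1, h) + 8 * t)%:R.
  by move: HG; rewrite mE => HG; apply: Phi_p2_even HG.
rewrite PG tE -signr_odd (_ : odd m = false); last by lia.
rewrite expr0 => /intrP[z]; move: oX; set X := 'C(_, _) => oX zE.
have : ((4 * X + 8 * t)%:Z)%:~R = (8 * z)%:~R :> rat.
  by rewrite intrM -zE -pmulrn; field.
move/intr_inj; lia.
Qed.

End OddWords.

(** For odd m the two sides have opposite signs. For even m the equation reduces to (2^k - 1) * 3 *
    X = 2t with every factor on the left odd. *)
Lemma shadow_contradiction k :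
  (0 < k)%N -> (2 ^+ k - 1) * Phi m 1 = 4 * (-1) ^+ m * Psi m (6 * m + 2) (wenum S) ->
  odd m \/ (exists2 h, m = (2 * h.+1)%N & odd 'C(5 * h.+1 - 1, h)) -> False.
Proof.
move=> k_gt0.
have /natrP[t ->] : Psi m (6 * m + 2) (wenum S) \is a Num.nat.
  by rewrite rpred_sum // => l _; rewrite rpredM ?rpred_nat ?coef_wenum_shadow.
have pow_gt1 : 1 < 2 ^+ k :> rat by rewrite exprn_egt1 // -lt0n.
move=> H [om|[h mE oX]].
  have := Phi1_odd om; move: H; rewrite -signr_odd om expr1 => H Phi_gt0.
  have : 0 < (2 ^+ k - 1) * Phi m 1 by rewrite mulr_gt0 // subr_gt0.
  by rewrite H; have := ler0n rat t; lra.
move: H; rewrite -signr_odd (_ : odd m = false) ?expr0; last by lia.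
rewrite mE Phi1_even mulr1; set X := 'C(_, _) in oX * => H.
have : (((2 ^ k)%N%:Z - 1) * 6 * X%:Z)%:~R = (4 * t)%N%:Z%:~R :> rat.
  rewrite -!pmulrn natrM -H !intrM intrB -!pmulrn natrX; ring.
move/intr_inj; have : (2 ^ k = 2 * 2 ^ k.-1)%N by rewrite -expnS prednK.
move: (2 ^ k)%N (2 ^ k.-1)%N => a b -> E3.
have {}E3 : (((2 * b)%N%:Z - 1) * 3 * X%:Z = 2 * t%:Z) by lia.
have [y XE] : exists y, X = (2 * y).+1 by exists X./2; lia.
by move: E3; rewrite XE; nia.
Qed.

Lemma extremal_dual_eq :
  odd m \/ (exists2 h, m = (2 * h.+1)%N & odd 'C(5 * h.+1 - 1, h)) ->
  dualc E \subset E.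
Proof.
move=> cond; have cD := card_dualc E0 ED.
have /(dvdn_pfactor _ _ (isT : prime 2))[x lex cE] : (#|E| %| 2 ^ (12 * m))%N.
  by rewrite -cD dvdn_mulr.
have cD' : #|dualc E| = (2 ^ (12 * m - x))%N.
  apply/eqP; rewrite -(@eqn_pmul2l (2 ^ x)) ?expn_gt0 // -{1}cE cD -expnD subnKC //.
have lex6 : (x <= 12 * m - x)%N.
  by have := subset_leq_card Eso; rewrite cE cD' leq_exp2l.
have [x6|x6] := eqVneq x (6 * m)%N.
  have/eqP <- : E == dualc E; last by [].
  by rewrite eqEcard Eso cE cD' leq_exp2l //; lia.
have [k k_gt0 kE] : exists2 k, (0 < k)%N & (6 * m = k + x)%N by exists (6 * m - x)%N; lia.
have e64 : 64 ^+ m = 2 ^+ k * #|E|%:R :> rat.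
  by rewrite cE natrX -exprD -kE exprM -natrX.
have cE_neq0 : #|E|%:R != 0 :> rat by rewrite cE pnatr_eq0 expn_eq0.
have main j : (J \in E)%:R = j :> rat -> ((1 + j) * 2 ^+ k - 2) * Phi m 1
    = 8 * (-1) ^+ m * Psi m (6 * m + 2) (wenum S).
  move=> <-; apply: (mulfI cE_neq0); have := main_identity; rewrite e64 => H.
  transitivity (((1 + (J \in E)%:R) * (2 ^+ k * #|E|%:R) - 2 * #|E|%:R) * Phi m 1); first by ring.
  by rewrite H; ring.
exfalso; case JE: (J \in E) main => main.
  (* With J in E, dividing by 2 gives the factor 2^k - 1. *)
  by apply: (shadow_contradiction k_gt0 _ cond); have := main 1 erefl; lra.
case: k k_gt0 kE e64 main => [|[|k]] // _ kE e64 main.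
  have cE2 : (2 * #|E|)%:R = 64 ^+ m :> rat by rewrite natrM e64 expr1.
  case: cond => [om|[h mE oX]]; first exact: (no_odd_words_odd (negbT JE) cE2 om).
  exact: (no_odd_words_even (negbT JE) cE2 mE oX).
(* Without J the factor is 2^(k+2) - 2, twice that for exponent k+1. *)
apply: (@shadow_contradiction k.+1 isT _ cond).
by have := main 0 erefl; rewrite exprS; lra.
Qed.

End Core.

(** * Fixed point free involutions *)

Section Involution.
Variables (N n : nat) (s : 'S_N).
Hypothesis NE : N = (2 * n)%N.
Hypothesis n_gt0 : (0 < n)%N.
Hypothesis ssK : involutive s.
Hypothesis s_fpf : fixed_point_free s.

Let reps : {set 'I_N} := [set i : 'I_N | (i < s i)%N].

Lemma repsC i : (s i \in reps) = (i \notin reps).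
Proof.
rewrite !inE ssK -leqNgt ltn_neqAle; have := s_fpf i.
by rewrite -val_eqE /= => ->.
Qed.

Lemma card_reps : #|reps| = n.
Proof.
have := cardsC reps; rewrite card_ord.
have -> : ~: reps = s @: reps.
  apply/setP => i; rewrite inE -[i in RHS]ssK mem_imset ?repsC //; exact: perm_inj.
by rewrite card_imset; [clear n_gt0; lia|exact: perm_inj].
Qed.

Definition orbit_rep (j : 'I_n) : 'I_N := enum_val (cast_ord (esym card_reps) j).

Lemma orbit_rep_in j : orbit_rep j \in reps.
Proof. exact: enum_valP. Qed.

(** [n_gt0] is there to supply the element witnessing that [reps] is inhabited, as [enum_rank_in]
    requires. *)
Definition orbit_index (i : 'I_N) : 'I_n :=
  cast_ord card_reps
    (enum_rank_in (orbit_rep_in (Ordinal n_gt0)) (if i \in reps then i else s i)).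

Lemma orbit_repK j : orbit_index (orbit_rep j) = j.
Proof.
by rewrite /orbit_index orbit_rep_in /orbit_rep enum_valK_in; apply/val_inj.
Qed.

Lemma orbit_indexK i : orbit_rep (orbit_index i) = if i \in reps then i else s i.
Proof.
rewrite /orbit_rep /orbit_index cast_ordK enum_rankK_in //.
by case: ifP => // /negbT; rewrite repsC.
Qed.

Lemma orbit_index_s i : orbit_index (s i) = orbit_index i.
Proof.
rewrite -[LHS]orbit_repK -[RHS]orbit_repK !orbit_indexK repsC ssK; congr orbit_index.
by case: (i \in reps).
Qed.

Lemma big_orbits (T : Type) (idx : T) (op : Monoid.com_law idx) (f : 'I_N -> T) :
  \big[op/idx]_i f i = \big[op/idx]_j op (f (orbit_rep j)) (f (s (orbit_rep j))).
Proof.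
have big_reps g : \big[op/idx]_(i in reps) g i = \big[op/idx]_j g (orbit_rep j).
  rewrite (reindex_onto orbit_rep orbit_index) => [|i ri]; last by rewrite orbit_indexK ri.
  by apply: eq_bigl => j; rewrite orbit_rep_in orbit_repK eqxx.
rewrite (bigID (mem reps)) /= big_split; congr (op _ _); first exact: big_reps.
rewrite (reindex_inj (@perm_inj _ s)) -(big_reps (fun i => f (s i))) /=.
by apply: eq_bigl => i; rewrite repsC negbK.
Qed.

Definition fold_word (x : 'rV['F_2]_N) : 'rV['F_2]_n := \row_j x 0 (orbit_rep j).
Definition lift_word (v : 'rV['F_2]_n) : 'rV['F_2]_N := \row_i v 0 (orbit_index i).

Lemma pactE (x : 'rV['F_2]_N) i : pact s x 0 i = x 0 (s i).
Proof. by rewrite mxE. Qed.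

Lemma pactK (x : 'rV['F_2]_N) : pact s (pact s x) = x.
Proof. by apply/rowP => i; rewrite !pactE ssK. Qed.

Lemma pactD (x y : 'rV['F_2]_N) : pact s (x + y) = pact s x + pact s y.
Proof. by apply/rowP => i; rewrite !mxE. Qed.

Lemma fold_lift v : fold_word (lift_word v) = v.
Proof. by apply/rowP => j; rewrite !mxE orbit_repK. Qed.

Lemma pact_lift v : pact s (lift_word v) = lift_word v.
Proof. by apply/rowP => i; rewrite !mxE orbit_index_s. Qed.

Lemma lift_fold x : pact s x = x -> lift_word (fold_word x) = x.
Proof.
move=> sx; apply/rowP => i; rewrite !mxE orbit_indexK; case: ifP => // _.
by rewrite -pactE sx.
Qed.

Lemma foldD x y : fold_word (x + y) = fold_word x + fold_word y.
Proof. by apply/rowP => j; rewrite !mxE. Qed.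

Lemma wt_lift v : wt (lift_word v) = (2 * wt v)%N.
Proof.
rewrite !wtE big_orbits big_distrr; apply: eq_bigr => j _ /=.
by rewrite !mxE orbit_index_s orbit_repK mul2n addnn.
Qed.

(** The trace is adjoint to the inclusion of fixed words. This makes the folded fixed words of a
    self-dual code the dual of its folded traces. *)
Lemma dot_fold x c : pact s x = x -> dotF2 (fold_word (c + pact s c)) (fold_word x) = dotF2 x c.
Proof.
move=> sx; rewrite [RHS]big_orbits; apply: eq_bigr => j _ /=.
by rewrite !mxE -[x 0 (s _)]pactE sx -mulrDr mulrC.
Qed.

Lemma pact_sym c : pact s (c + pact s c) = c + pact s c.
Proof. by rewrite pactD pactK addrC. Qed.

End Involution.

(** Let f = 1 + s. The hypothesis makes K, the fixed words of C, equal to f(C). A complement B of K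
    in C meets the kernel of f trivially, so f maps B isomorphically onto K; a basis of B then
    generates C freely. *)
Lemma free_of_trace_surj n (s : 'S_n) (C : {vspace 'rV['F_2]_n}) :
  involutive s -> in_Aut s C ->
  (forall x, x \in C -> pact s x = x -> exists2 c, c \in C & x = c + pact s c) ->
  free_module_order2 s C.
Proof.
move=> ssK autC surj.
have tr_lin : linear (fun x : 'rV['F_2]_n => x + pact s x).
  by move=> a x y; apply/rowP => i; rewrite !mxE; ring.
pose trL := GRing.isLinear.Build _ _ _ _ _ tr_lin.
pose tr : {linear 'rV['F_2]_n -> 'rV['F_2]_n} := HB.pack (fun x : 'rV['F_2]_n => x + pact s x) trL.
pose f : 'End('rV['F_2]_n) := linfun tr.
have fE x : f x = x + pact s x by rewrite lfunE.
have psK x : pact s (pact s x) = x by apply/rowP => i; rewrite !mxE ssK.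
have oppF2 (x : 'rV['F_2]_n) : - x = x by apply/eqP; rewrite eq_sym -addr_eq0 addF2.
pose K := (C :&: lker f)%VS.
have fK x : (f x == 0) = (pact s x == x) by rewrite fE addr_eq0 oppF2 eq_sym.
have fC : (f @: C)%VS = K.
  apply/eqP; rewrite eqEsubv; apply/andP; split; apply/subvP => x.
    case/memv_imgP => c Cc ->; rewrite memv_cap memv_ker fK fE rpredD ?autC //=.
    by rewrite /pact linearD /= -![col_perm s _]/(pact s _) psK addrC.
  rewrite memv_cap memv_ker fK => /andP[Cx /eqP sx].
  by have [c Cc ->] := surj x Cx sx; rewrite -fE memv_img.
pose B := (C :\: K)%VS.
have BK0 : (B :&: K = 0)%VS by exact: capv_diff.
have CE : (B + K)%VS = C.
  by rewrite -[RHS](addv_diff_cap C K); congr (_ + _)%VS; rewrite /K capvA capvv.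
have BC : (B <= C)%VS by rewrite -CE addvSl.
have fB : (f @: B)%VS = K.
  rewrite -fC -CE limgD (_ : f @: K = 0)%VS ?addv0 //; apply/eqP.
  by rewrite -lkerE capvSr.
have dimK : \dim K = \dim B.
  rewrite -fB -[RHS](limg_ker_dim f B) (_ : B :&: lker f = 0)%VS ?dimv0 //.
  apply/eqP; rewrite -subv0 -BK0 subv_cap capvSl /= /K subv_cap capvSr andbT.
  exact: subv_trans (capvSl _ _) BC.
have bB := vbasisP B.
exists (\dim B), (vbasis B).
have spE : (<<vbasis B ++ map (pact s) (vbasis B)>> = C)%VS.
  apply/eqP; rewrite eqEsubv; apply/andP; split.
    apply/span_subvP => x; rewrite mem_cat => /orP[/vbasis_mem/(subvP BC)//|].
    by case/mapP => y /vbasis_mem/(subvP BC) Cy ->; rewrite autC.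
  rewrite -CE span_cat subv_add; apply/andP; split.
    by rewrite (span_basis bB) addvSl.
  rewrite -fB -{1}(span_basis bB) limg_span; apply/span_subvP => x /mapP[y yB ->].
  by rewrite fE memv_add ?memv_span ?map_f.
split=> //.
  by apply/allP => x /vbasis_mem/(subvP BC).
(* The family spans C and has 2 dim B = dim B + dim K = dim C members. *)
rewrite /free spE size_cat size_map size_tuple -CE dimv_disjoint_sum //.
by rewrite dimK.
Qed.

(* Passage from the automorphism to the folded codes *)
Local Close Scope ring_scope.

Theorem theorem1p1 (m : nat) (C : {vspace 'rV['F_2]_(24 * m)})
  (s : 'S_(24 * m)) :
  extremal C -> in_Aut s C -> #[s]%g = 2 -> fixed_point_free s ->
  (odd m \/ exists mu : nat, m = (2 * mu)%N /\ odd 'C(5 * mu - 1, mu - 1)) ->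
  free_module_order2 s C.
Proof.
move=> [sdC [[c0 _ /andP[c0_neq0 _]] dC]] autC os fpf cond.
have m_gt0 : (0 < m)%N.
  (* For m = 0 there are no coordinates, hence no nonzero word [c0]. *)
  case: m C s sdC c0 c0_neq0 {dC autC os fpf cond} => // C s _ c0 /negP[].
  by apply/eqP/rowP => -[].
have cond' : odd m \/ (exists2 h, m = (2 * h.+1)%N & odd 'C(5 * h.+1 - 1, h)).
  case: cond => [|[[|h] [mE oX]]]; [by left|by move: m_gt0; rewrite mE|].
  by right; exists h => //; move: oX; rewrite subSS subn0.
have ssK : involutive s.
  have s2 : (s ^+ 2)%g = 1%g by have := expg_order s; rewrite os.
  by move=> i; rewrite -permM -[(s * s)%g]/(s ^+ 2)%g s2 perm1.
have NE : (24 * m = 2 * (12 * m))%N by lia.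
have n_gt0 : (0 < 12 * m)%N by lia.
pose fd := fold_word NE ssK fpf; pose lft := lift_word NE n_gt0 ssK fpf.
pose E := [set fd (c + pact s c)%R | c in [set c | c \in C]].
have trC c : c \in C -> (c + pact s c)%R \in C by move=> Cc; rewrite rpredD ?autC.
have E_tr c : c \in C -> fd (c + pact s c)%R \in E.
  by move=> Cc; apply/imsetP; exists c; rewrite ?inE.
have dualP x : pact s x = x -> x \in C -> fd x \in dualc E.
  move=> sx Cx; rewrite inE; apply/forall_inP => _ /imsetP[c + ->]; rewrite inE => Cc.
  by rewrite dot_fold //; apply/eqP; apply: (sdC x).1.
(* The lift of a dual word is orthogonal to C by adjointness, hence lies in C by self-duality. *)
have liftC v : v \in dualc E -> lft v \in C.
  move=> Dv; apply/sdC => c Cc.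
  rewrite -(dot_fold NE n_gt0 ssK fpf c (pact_lift NE n_gt0 ssK fpf v)) fold_lift.
  exact: dual_dot (E_tr c Cc) Dv.
have E0 : 0%R \in E.
  have := E_tr 0%R (mem0v _); rewrite (_ : fd _ = 0%R) //.
  by apply/rowP => j; rewrite !mxE addr0.
have ED : {in E &, forall x y, (x + y)%R \in E}.
  move=> _ _ /imsetP[c + ->] /imsetP[d + ->]; rewrite !inE => Cc Cd.
  have -> : (fd (c + pact s c) + fd (d + pact s d) = fd ((c + d) + pact s (c + d)))%R.
    by rewrite -foldD pactD addrACA.
  by apply: E_tr; rewrite rpredD.
have Eso : E \subset dualc E.
  apply/subsetP => _ /imsetP[c + ->]; rewrite inE => Cc.
  by apply: dualP; [exact: pact_sym|exact: trC].
(* Lifting doubles the weight, so the distance 4m+4 becomes 2m+2. *)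
have Dmin v : v \in dualc E -> v != 0%R -> (2 * m + 2 <= wt v)%N.
  move=> Dv v0; have := dC _ (liftC v Dv); rewrite wt_lift.
  have -> : lft v != 0%R.
    apply: contraNneq v0 => lv0; rewrite -(fold_lift NE n_gt0 ssK fpf v) -/lft lv0.
    by apply/eqP/rowP => j; rewrite !mxE.
  by move/(_ isT); lia.
have DE := extremal_dual_eq m_gt0 E0 ED Eso Dmin cond'.
apply: free_of_trace_surj => // x Cx sx.
have /imsetP[c + fx] := subsetP DE _ (dualP x sx Cx); rewrite inE => Cc.
exists c => //; rewrite -(lift_fold NE n_gt0 ssK fpf sx) -/fd fx.
by rewrite lift_fold // pact_sym.
Qed.
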